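(* Let $\mathcal G^*_\infty$ be a connected doubly-periodic tame planar graph with vertex set $\mathcal V_\infty$ and an exhausting sequence of finite subgraphs $\{\mathcal G^*_L\}_L$, and let $U:\mathbb Z\to\mathbb R$ be a convex, annealed Gaussian interaction. Assume that for some vertex $x\in\mathcal V_\infty$, $\sup_L\mathbb E^{U,\mathcal G^*_L}[n_x^2]<\infty$. Then the sequence $\{\mathbb P^{U,\mathcal G^*_L}\}_L$ converges (in the sense of convergence of finite-dimensional marginal distributions) to an infinite-volume Gibbs measure. This limit is independent of the choice of the exhausting sequence $\{\mathcal G^*_L\}_L$, and is invariant under the automorphisms of $\mathcal G^*_\infty$.
   Context: Doubly-periodic: the graph has an embedding in $\mathbb R^2$ for which the translations by $\mathbb Z^2$ act as graph automorphisms. Tame: under this embedding the vertex set has no accumulation point. Annealed Gaussian interaction: a function $U:\mathbb Z\to\mathbb R$ for which there is a finite non-negative Borel measure $\mu_U$ on $[0,\infty)$ with $e^{-U(q)}=\int_{[0,\infty)}e^{-\frac12\lambda q^2}\,d\mu_U(\lambda)$ for all $q\in\mathbb Z$; $U$ is non-constant so that the measures below are well defined. For a finite subgraph $\mathcal G^*_L=(\mathcal V^*_L,\mathcal E^*_L)$, with $\partial\mathcal V^*_L$ the set of its vertices having a neighbor in $\mathcal G^*_\infty$ outside of it, $\mathbb P^{U,\mathcal G^*_L}$ (expectation $\mathbb E^{U,\mathcal G^*_L}$) is the probability measure on $n:\mathcal V^*_L\to\mathbb Z$ with $n=0$ on $\partial\mathcal V^*_L$ giving $n$ probability proportional to $\prod_{\{x,y\}\in\mathcal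 E^*_L}e^{-U(n_x-n_y)}$. An infinite-volume Gibbs measure is a probability measure on $\mathbb Z^{\mathcal V_\infty}$ whose conditional distributions in finite sets given the outside satisfy the DLR equations for the nearest-neighbor potential $U$.
   Formalization: The finite subgraphs in an exhausting sequence are taken to be induced (all edges of the infinite graph between their vertices); for general subgraphs, with the boundary defined by outside neighbors, the measures may be undefined or the limit may depend on the sequence. *)

(* Defs.v *)
From HB Require Import structures.
From mathcomp Require Import all_boot all_order all_algebra.
From mathcomp Require Import all_classical all_reals all_analysis.

Set Implicit Arguments.
Unset Strict Implicit.
Unset Printing Implicit Defensive.

Import Order.TTheory GRing.Theory Num.Theory.
Import numFieldNormedType.Exports.

Local Open Scope classical_set_scope.
Local Open Scope ring_scope.

HB.instance Definition _ := isPointed.Build int (Posz 0).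

Section graph.
Context {R : realType} {V : choiceType}.
Implicit Types (adj : rel V) (S : set V).

Definition simple_graph adj := symmetric adj /\ irreflexive adj.

Definition connected_graph adj :=
  forall x y, exists2 p : seq V, path adj x p & last x p = y.

Definition automorphism adj (s : V -> V) :=
  bijective s /\ forall x y, adj (s x) (s y) = adj x y.

(* An embedding of the graph in the plane, that is, a homeomorphism from the
   graph, seen as a one-dimensional cell complex, onto its image. The edge
   {x, y} is drawn as the arc [arc x y], parametrized by [0, 1] from x to y;
   [arc x y] is only meaningful when [adj x y]. *)
Record drawing adj := Drawing {
  pos : V -> R * R ;
  arc : V -> V -> R -> R * R ;
  pos_inj : injective pos ;
  arc0 : forall x y, adj x y -> arc x y 0 = pos x ;
  arc1 : forall x y, adj x y -> arc x y 1 = pos y ;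
  arc_continuous : forall x y, adj x y -> {within `[0, 1], continuous (arc x y)} ;
  arc_rev : forall x y t, adj x y -> `[0, 1]%classic t ->
    arc y x t = arc x y (1 - t) ;
  arc_avoids_pos : forall x y z t, adj x y -> `]0, 1[%classic t ->
    arc x y t != pos z ;
  arc_meet : forall x y x' y' t t', adj x y -> adj x' y' ->
    `]0, 1[%classic t -> `]0, 1[%classic t' -> arc x y t = arc x' y' t' ->
    [/\ x = x', y = y' & t = t'] \/ [/\ x = y', y = x' & t = 1 - t'] ;
  (* The planar topology of the image is the topology of the cell complex: a
     set whose trace on every edge is open is open in the image. Among other
     things this forces every degree to be finite. *)
  arc_weak_topology : forall A : set (R * R),
    (forall x y, adj x y -> exists2 O : set R, open O &
       `[0, 1] `&` arc x y @^-1` A = `[0, 1] `&` O) ->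
    let image :=
      range pos `|` [set p | exists x y, adj x y /\ (arc x y @` `[0, 1]) p] in
    exists2 O : set (R * R), open O & image `&` A = image `&` O }.

(* Translations by Z^2 map the drawing, vertices and edges, to itself. *)
Definition doubly_periodic adj (D : drawing adj) :=
  forall a b : int, exists s : V -> V,
    [/\ automorphism adj s,
        forall x, pos D (s x) = pos D x + (a%:~R, b%:~R) &
        forall x y, adj x y -> arc D (s x) (s y) @` `[0, 1] =
          [set p + (a%:~R, b%:~R) | p in arc D x y @` `[0, 1]] ].

Definition tame adj (D : drawing adj) := limit_point (range (pos D)) = set0.

(* Finite subgraphs are induced, hence given by their vertex sets. *)
Definition exhausting (G : nat -> set V) :=
  [/\ forall L, finite_set (G L),
      forall L, G L `<=` G L.+1 &
      \bigcup_L G L = setT].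

Definition boundary adj S := [set x | S x /\ exists2 y, adj x y & ~ S y].

(* Edges are represented by ordered pairs, so that each of them occurs twice. *)
Definition edges_inside adj S : set (V * V) :=
  [set e | [/\ adj e.1 e.2, S e.1 & S e.2]].

Definition edges_meeting adj S : set (V * V) :=
  [set e | adj e.1 e.2 /\ (S e.1 \/ S e.2)].

End graph.

Arguments drawing R {V} adj.

Section interaction.
Context {R : realType}.
Implicit Types U : int -> R.

Definition annealed_gaussian U :=
  exists mu : {finite_measure set R -> \bar R}, forall q : int,
    ((expR (- U q))%:E =
     \int[mu]_(l in `[0%R, +oo[) (expR (- (2^-1 * l * q%:~R ^+ 2)))%:E)%E.

Definition nonconstant U := exists p q, U p <> U q.

Definition convex_interaction U := forall p q r : int, p <= q -> q <= r ->
  (r - p)%:~R * U q <= (r - q)%:~R * U p + (q - p)%:~R * U r.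

End interaction.

Definition cylinders (V : choiceType) (S : set V) : set (set (V -> int)) :=
  [set A | exists x k, S x /\ A = [set n | n x = k]].

(* Height functions, with the product of the discrete sigma-algebras. *)
Notation config V := (g_sigma_algebraType (@cylinders V [set: V])).

Section gibbs.
Context {R : realType} {V : choiceType}.
Implicit Types (U : int -> R) (adj : rel V) (S : set V) (E : set (V * V)).
Implicit Types (D A B : set (config V)) (n eta : config V).

(* The factor 1/2 compensates the double occurrence of the edges in E; an
   annealed Gaussian interaction is even. *)
Definition energy U E n : R :=
  2^-1 * \sum_(e \in E) U (n e.1 - n e.2).

Definition boltzmann U E D A : \bar R :=
  (\esum_(n in A `&` D) (expR (- energy U E n))%:E)%E.

Section boltzmann_measure.
Variables (U : int -> R) (E : set (V * V)) (D : set (config V)).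
Local Open Scope ereal_scope.

Let boltzmann0 : boltzmann U E D set0 = 0.
Proof. by rewrite /boltzmann set0I esum_set0. Qed.

Let boltzmann_ge0 A : 0 <= boltzmann U E D A.
Proof. by apply: esum_ge0 => n _; rewrite lee_fin expR_ge0. Qed.

Let boltzmann_sigma_additive : semi_sigma_additive (boltzmann U E D).
Proof.
move=> F _ tF _.
have -> : boltzmann U E D (\bigcup_i F i) =
    \sum_(0 <= i <oo) boltzmann U E D (F i).
  rewrite /boltzmann setI_bigcupl nneseries_sum_bigcup//.
  exact: trivIset_setIr.
by apply: is_cvg_nneseries => i _ _; exact: boltzmann_ge0.
Qed.

HB.instance Definition _ := isMeasure.Build _ (config V) R (boltzmann U E D)
  boltzmann0 boltzmann_ge0 boltzmann_sigma_additive.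

End boltzmann_measure.

(* In [mnormalize m P], P is a default value for the case where the total mass
   of m is 0 or infinite. *)

(* The law of n on the finite subgraph induced by S, where n is extended by 0
   outside of S. *)
Definition finite_volume U adj S : probability (config V) R :=
  mnormalize
    (boltzmann U (edges_inside adj S)
      [set n | forall x, ~ S x \/ boundary adj S x -> n x = 0])
    (\d_ ((fun=> 0) : config V)).

(* The conditional law in S given the heights eta outside of S. *)
Definition specification U adj S eta : probability (config V) R :=
  mnormalize
    (boltzmann U (edges_meeting adj S)
      [set n | forall x, ~ S x -> n x = eta x])
    (\d_ eta).

Definition gibbs_measure U adj (P : probability (config V) R) :=
  forall S, finite_set S -> forall A B, measurable A ->
    <<s cylinders (~` S) >> B ->
    (P (A `&` B) = \int[P]_(eta in B) specification U adj S eta A)%E.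

(* Since the heights are integers, the marginals on a finite set F converge iff
   the probability of every event depending only on the heights in F does. *)
Definition fdd_cvg (P_ : nat -> probability (config V) R)
    (P : probability (config V) R) :=
  forall F : set V, finite_set F ->
  forall A, (forall n n', (forall x, F x -> n x = n' x) -> A n -> A n') ->
    P_ L A @[L --> \oo] --> P A.

Definition automorphism_invariant adj (P : probability (config V) R) :=
  forall s, automorphism adj s -> forall A, measurable A ->
    P [set n | A (fun x => n (s x))] = P A.

End gibbs.

(* Main.v *)
(* Every edge weight h = exp(-U) is a mixture of Gaussians. Duplicating the field
   and passing to (n, m) = (p + u + v, u - v), the symmetrized product of two edge
   weights becomes a mixture of exp(-a) exp(-b) cosh(c u v), a positive definite
   kernel in (u, v). This yields Ginibre's inequality: if F and H have positive
   definite differences F(u - v) - F(p + u + v), they are positively correlated.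
   Taking for H the indicator function of {n = 0 outside of K} shows that the
   expectation of F under zero boundary conditions is monotone in the volume;
   applied to 1{n_Y = 0} and to 2 1{n_Y = 0} + 1{n_Y = a} + 1{n_Y = -a},
   this shows that the probabilities of {n_Y = a} converge along the directed set
   of all finite volumes, whence the independence of the exhausting sequence and
   the invariance under automorphisms.

   No mass is lost in the limit: the product of the weights of all edges
   but {x, y} times 2 1{q' = 0} - 1{q' = q} - 1{q' = -q}, where q' = n_x - n_y, is
   positive definite, and averaging over large boxes shows that its sum is
   nonnegative. Hence P(n_x - n_y = q) <= 2 h(q) / h(0) uniformly in the volume,
   so that tightness at one vertex, granted by the second moments, propagates
   along the connected graph. Kolmogorov's extension then gives the limiting
   measure, and the DLR equations hold on the elementary cylinders, hence
   everywhere by a monotone class argument. *)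
Require Import Defs.
From HB Require Import structures.
From mathcomp Require Import all_boot all_order all_algebra.
From mathcomp Require Import finmap ring lra zify.
From mathcomp Require Import all_classical all_reals all_analysis.
From mathcomp Require Import measurable_realfun.

Set Implicit Arguments.
Unset Strict Implicit.
Unset Printing Implicit Defensive.

Import Order.TTheory GRing.Theory Num.Theory.
Import numFieldNormedType.Exports.

Local Open Scope classical_set_scope.
Local Open Scope ring_scope.

(** * Positive kernels and their closure properties *)

Section positive_kernels.
Context {R : realType}.

(** Convexity enters through linear growth: together with evenness and nonconstancy it gives
    [U q >= c * |q| - C] with [c > 0]. As the vertex set is infinite, every vertex of a finite
    volume is linked by a path to a pinned one, so partition functions are finite and the bound on
    gradients is summable. The drawing yields finite degrees, and its translations an infinite
    vertex set. Gaussian functions of [n x] are positive definite, hence decrease in the volume, and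
    they compare with tail indicators from both sides; this carries tightness from a cofinal family
    to every volume. Volumes are parametrized by their free vertices [K], with zero heights outside;
    pinning the boundary of [S] amounts to taking for [K] the interior of [S]. *)

Definition psd (I : finType) (A : I -> I -> R) :=
  forall c : I -> R, 0 <= \sum_i \sum_j c i * c j * A i j.

Definition posker (T : Type) (k : T -> T -> R) :=
  forall (I : finType) (A : I -> I -> R) (x : I -> T), psd A ->
    0 <= \sum_i \sum_j A i j * k (x i) (x j).

Lemma posker_ext (T : Type) (k k' : T -> T -> R) :
  (forall u v, k u v = k' u v) -> posker k -> posker k'.
Proof.
move=> kk' pk I A x pA; have := pk I A x pA.
by under eq_bigr do under eq_bigr do rewrite kk'.
Qed.

Lemma posker_rank1 (T : Type) (g : T -> R) : posker (fun u v => g u * g v).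
Proof.
move=> I A x pA; have := pA (g \o x).
by under eq_bigr do under eq_bigr do rewrite mulrC.
Qed.

Lemma posker1 (T : Type) : posker (fun _ _ : T => 1).
Proof.
by apply: posker_ext (posker_rank1 (fun=> 1)) => u v; rewrite mulr1.
Qed.

Lemma posker0 (T : Type) : posker (fun _ _ : T => 0).
Proof.
by apply: posker_ext (posker_rank1 (fun=> 0)) => u v; rewrite mulr0.
Qed.

Lemma poskerD (T : Type) (k k' : T -> T -> R) :
  posker k -> posker k' -> posker (fun u v => k u v + k' u v).
Proof.
move=> pk pk' I A x pA; under eq_bigr do under eq_bigr do rewrite mulrDr.
under eq_bigr do rewrite big_split/=.
by rewrite big_split/= addr_ge0 ?pk ?pk'.
Qed.

(** Schur's product theorem without diagonalization: if [A] is positive semidefinite, so is the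
    matrix [c i * c j * A i j], and testing [k] on it shows that the entrywise product of [A] with
    [k] is again positive semidefinite, hence a legitimate test for [k']. *)
Lemma poskerM (T : Type) (k k' : T -> T -> R) :
  posker k -> posker k' -> posker (fun u v => k u v * k' u v).
Proof.
move=> pk pk' I A x pA.
have pAk : psd (fun i j => A i j * k (x i) (x j)).
  move=> c; have pcA : psd (fun i j => c i * c j * A i j).
    move=> d; have := pA (fun i => d i * c i).
    congr (0 <= _); apply: eq_bigr => i _; apply: eq_bigr => j _.
    by ring.
  have := pk I _ x pcA.
  by under eq_bigr do under eq_bigr do rewrite -mulrA.
have := pk' I _ x pAk.
by under eq_bigr do under eq_bigr do rewrite -mulrA.
Qed.

Lemma poskerZ (T : Type) (a : R) (k : T -> T -> R) :
  0 <= a -> posker k -> posker (fun u v => a * k u v).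
Proof.
move=> a0 pk; apply: poskerM pk.
apply: posker_ext (posker_rank1 (fun=> Num.sqrt a)) => u v.
by rewrite -expr2 sqr_sqrtr.
Qed.

Lemma posker_sum (T : Type) (J : Type) (s : seq J) (k : J -> T -> T -> R) :
  (forall j, posker (k j)) -> posker (fun u v => \sum_(j <- s) k j u v).
Proof.
move=> pk; elim: s => [|j s IH].
  by apply: posker_ext (@posker0 T) => u v; rewrite big_nil.
by apply: posker_ext (poskerD (pk j) IH) => u v; rewrite big_cons.
Qed.

Lemma posker_prod (T : Type) (J : eqType) (s : seq J) (k : J -> T -> T -> R) :
  (forall j, j \in s -> posker (k j)) ->
  posker (fun u v => \prod_(j <- s) k j u v).
Proof.
elim: s => [|j s IH] pk.
  by apply: posker_ext (@posker1 T) => u v; rewrite big_nil.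
have pj : posker (k j) by apply: pk; rewrite mem_head.
have {}IH : posker (fun u v => \prod_(j <- s) k j u v).
  by apply: IH => i si; apply: pk; rewrite inE si orbT.
by apply: posker_ext (poskerM pj IH) => u v; rewrite big_cons.
Qed.

Lemma posker_comp (S T : Type) (f : S -> T) (k : T -> T -> R) :
  posker k -> posker (fun u v => k (f u) (f v)).
Proof. by move=> pk I A x pA; exact: pk I A (f \o x) pA. Qed.

Lemma posker_cvg (T : Type) (k_ : nat -> T -> T -> R) (k : T -> T -> R) :
  (forall n, posker (k_ n)) -> (forall u v, k_ n u v @[n --> \oo] --> k u v) ->
  posker k.
Proof.
move=> pk kk I A x pA.
apply: (@ler_cvg_to nat \oo _ R (cst 0) (fun n =>
  \sum_i \sum_j A i j * k_ n (x i) (x j))).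
- exact: cvg_cst.
- apply: cvg_big => [|i _]; first exact: add_continuous.
  apply: cvg_big => [|j _]; first exact: add_continuous.
  by apply: cvgMr; exact: kk.
- by apply: nearW => n; exact: pk.
Qed.

(** The kernel is the sum over [z] of the rank-one kernels 1{u = z} 1{v = z}; for given points only
    finitely many [z] matter. *)
Lemma posker_eq (T : eqType) : posker (fun u v : T => (u == v)%:R).
Proof.
move=> I A x pA.
pose s := undup [seq x i | i <- enum I].
have pz z : 0 <= \sum_i \sum_j A i j * ((x i == z)%:R * (x j == z)%:R).
  exact: (posker_rank1 (fun u => (u == z)%:R)) pA.
have : 0 <= \sum_(z <- s)
    \sum_i \sum_j A i j * ((x i == z)%:R * (x j == z)%:R).
  by apply: sumr_ge0 => z _; exact: pz.
rewrite exchange_big/=; under eq_bigr do rewrite exchange_big/=.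
congr (0 <= _); apply: eq_bigr => i _; apply: eq_bigr => j _.
rewrite -mulr_sumr; congr (_ * _); suff -> : \sum_(z <- s) (x i == z)%:R * (x j == z)%:R =
    (x i == x j)%:R :> R by [].
rewrite (bigD1_seq (x i)) ?undup_uniq//=; last first.
  by rewrite mem_undup map_f// mem_enum.
rewrite eqxx mul1r big1 ?addr0 1?eq_sym// => z zi.
by rewrite eq_sym (negbTE zi) mul0r.
Qed.

Lemma sum_pair (I J : finType) (F : I * J -> R) :
  \sum_p F p = \sum_i \sum_j F (i, j).
Proof. by rewrite pair_bigA; apply: eq_bigr => -[]. Qed.

(** If [k] is the Gram kernel of a feature map, this is the one of the combination with coefficients
    [s a] of its composites with the [f a]. The combinations needed below are the identity minus a
    reflection, and the identity plus or minus a translation. *)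
Lemma posker_double (T : Type) (J : finType) (s : J -> R) (f : J -> T -> T)
    (k : T -> T -> R) : posker k ->
  posker (fun u v => \sum_a \sum_b s a * s b * k (f a u) (f b v)).
Proof.
move=> pk I A x pA.
have pA' : psd (fun p q : I * J => A p.1 q.1 * (s p.2 * s q.2)).
  move=> c; have := pA (fun i => \sum_a c (i, a) * s a).
  congr (0 <= _); rewrite sum_pair; apply: eq_bigr => i _.
  under [RHS]eq_bigr do rewrite sum_pair.
  rewrite [RHS]exchange_big/=; apply: eq_bigr => j _.
  rewrite big_distrlr/= mulr_suml; apply: eq_bigr => a _.
  by rewrite mulr_suml; apply: eq_bigr => b _; ring.
have := pk _ _ (fun p => f p.2 (x p.1)) pA'.
congr (0 <= _); rewrite sum_pair; apply: eq_bigr => i _.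
under eq_bigr do rewrite sum_pair.
rewrite exchange_big/=; apply: eq_bigr => j _.
rewrite mulr_sumr; apply: eq_bigr => a _.
by rewrite mulr_sumr; apply: eq_bigr => b _; ring.
Qed.

Lemma cvg_exp_coeff (x : R) :
  \sum_(0 <= i < n) x ^+ i / i`!%:R @[n --> \oo] --> expR x.
Proof. exact: is_cvg_series_exp_coeff. Qed.

(* The odd terms of the two exponential series cancel. *)
Lemma posker_cosh (c : R) :
  posker (fun x y : R => expR (c * (x * y)) + expR (- (c * (x * y)))).
Proof.
pose k_ n (x y : R) :=
  \sum_(0 <= i < n) (c ^+ i + (- c) ^+ i) / i`!%:R * (x ^+ i * y ^+ i).
apply: (@posker_cvg _ k_) => [n|x y].
  apply: posker_sum => i; apply: poskerZ (posker_rank1 (fun x => x ^+ i)).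
  rewrite divr_ge0 ?ler0n// exprNn.
  rewrite -signr_odd -[X in X + _]mul1r -mulrDl; case: (boolP (odd i)) => oi/=.
    by rewrite expr1 subrr mul0r.
  by rewrite expr0 mulr_ge0// exprn_even_ge0.
rewrite (_ : k_ ^~ x ^~ y = fun n =>
  \sum_(0 <= i < n) (c * (x * y)) ^+ i / i`!%:R +
  \sum_(0 <= i < n) (- (c * (x * y))) ^+ i / i`!%:R).
  by apply: cvgD; exact: cvg_exp_coeff.
apply/funext => n; rewrite -big_split/=; apply: eq_bigr => i _.
by rewrite -mulNr !exprMn; ring.
Qed.

Lemma posker_exp : posker (fun x y : R => expR (x * y)).
Proof.
apply: (@posker_cvg _ (fun n x y => \sum_(0 <= i < n) (x * y) ^+ i / i`!%:R)).
  move=> n; apply: posker_sum => i; rewrite -[X in posker X]/_.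
  have := poskerZ _ (posker_rank1 (fun x : R => x ^+ i)).
  move=> /(_ i`!%:R^-1); rewrite invr_ge0 ler0n => /(_ isT).
  by apply: posker_ext => u v; rewrite exprMn mulrC.
by move=> u v; exact: cvg_exp_coeff.
Qed.

Lemma posker_gauss (a : R) : 0 <= a ->
  posker (fun x y : int => expR (- (2^-1 * a * ((x - y)%:~R) ^+ 2))).
Proof.
move=> a0.
have := poskerM (posker_rank1 (fun x : R => expR (- (2^-1 * x ^+ 2)))) posker_exp.
move=> /(posker_comp (fun x : int => Num.sqrt a * x%:~R)).
apply: posker_ext => x y; rewrite -!expRD; congr expR.
by rewrite intrB -[in RHS](sqr_sqrtr a0); field.
Qed.

(** With [X = p + 2u] and [Y = p + 2v] the arguments are [(X + Y) / 2] and [(X - Y) / 2], and the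
    exponents combine to [-(a + b)(X^2 + Y^2) / 8 - (a - b) X Y / 4] and the same with the opposite
    cross term. The sum is thus a rank-one kernel times twice a hyperbolic cosine. *)
Lemma posker_gauss_pair (a b : R) (p : int) :
  let e l (q : int) := expR (- (2^-1 * l * q%:~R ^+ 2)) in
  posker (fun u v : int => e a (p + u + v) * e b (u - v) +
                           e b (p + u + v) * e a (u - v)).
Proof.
move=> e.
have := poskerM
  (posker_rank1 (fun x : R => expR (- (8^-1 * (a + b) * x ^+ 2))))
  (posker_cosh ((a - b) / 4)).
move=> /(posker_comp (fun x : int => (p + x *+ 2)%:~R)).
apply: posker_ext => u v; rewrite /e -!expRD mulrDr -!expRD addrC.
by congr (expR _ + expR _); rewrite ?(intrD, intrB, intrM, mulrzr, rmorphMn)/=; field.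
Qed.

End positive_kernels.

(** * Kernels built from mixtures of Gaussians *)

Section annealed_gaussian_kernels.
Context {R : realType} (U : int -> R) (mu : {finite_measure set R -> \bar R}).
Hypothesis Umu : forall q : int, ((expR (- U q))%:E =
  \int[mu]_(l in `[0%R, +oo[) (expR (- (2^-1 * l * q%:~R ^+ 2)))%:E)%E.

Let e (l : R) (q : int) := expR (- (2^-1 * l * q%:~R ^+ 2)).
Let h q := expR (- U q).

Let integrable_e q : mu.-integrable `[0, +oo[ (EFin \o (e ^~ q)).
Proof.
apply: (@le_integrable _ _ _ _ _ _ _ (cst 1%E)) => //.
- apply/measurable_EFinP; apply: measurable_funTS.
  apply: measurableT_comp => //; apply: measurableT_comp => //.
  by apply: measurable_funM => //; exact: measurable_funM.
- move=> l; rewrite /= in_itv/= andbT => l0.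
  rewrite lee_fin normr1 ger0_norm ?expR_ge0// -expR0 ler_expR oppr_le0.
  by rewrite mulr_ge0 ?sqr_ge0// mulr_ge0.
- exact: finite_measure_integrable_cst.
Qed.

Let mixture_sum (J : Type) (s : seq J) (c : J -> R) (q : J -> int) :
  mu.-integrable `[0, +oo[ (fun l => (\sum_(j <- s) c j * e l (q j))%:E) /\
  ((\sum_(j <- s) c j * h (q j))%:E =
   \int[mu]_(l in `[0%R, +oo[) (\sum_(j <- s) c j * e l (q j))%:E)%E.
Proof.
elim: s => [|j s [IHi IH]].
  rewrite big_nil (_ : (fun _ => _) = cst 0%E); last first.
    by apply/funext => l; rewrite big_nil.
  split; first exact: integrable0.
  by rewrite integral0.
have ij : mu.-integrable `[0, +oo[ (fun l => (c j)%:E * (e l (q j))%:E)%E.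
  by apply: integrableZl => //; exact: integrable_e.
split.
  rewrite (_ : (fun _ => _) = (fun l => (c j)%:E * (e l (q j))%:E +
      (\sum_(j <- s) c j * e l (q j))%:E)%E); first exact: integrableD.
  by apply/funext => l; rewrite big_cons EFinD EFinM.
under eq_integral do rewrite big_cons EFinD EFinM.
rewrite integralD//= integralZl//=; last exact: integrable_e.
by rewrite -IH -Umu big_cons.
Qed.

(** Integration in [l] preserves nonnegativity, so an inequality linear in the values of [h] may be
    checked for each Gaussian [e l] separately. *)
Lemma mixture_ge0 (J : finType) (c : J -> R) (q : J -> int) :
  (forall l, 0 <= l -> 0 <= \sum_j c j * e l (q j)) ->
  0 <= \sum_j c j * h (q j).
Proof.
move=> ce; rewrite -lee_fin (mixture_sum _ c q).2; apply: integral_ge0 => l.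
by rewrite /= in_itv/= andbT lee_fin; exact: ce.
Qed.

Lemma posker_mixture : posker (fun x y : int => h (x - y)).
Proof.
move=> I A x pA; have := @mixture_ge0 (I * I)%type (fun p => A p.1 p.2)
  (fun p => x p.1 - x p.2).
rewrite sum_pair; apply => l l0; rewrite sum_pair.
exact: (@posker_gauss R l l0 I A x pA).
Qed.

(* h(a) h(b) is a mixture over pairs (l, l'); symmetrizing in (l, l') makes the
   kernel positive for each pair. *)
Lemma posker_mixture_pair p :
  posker (fun u v : int => h (p + u + v) * h (u - v)).
Proof.
move=> I A x pA; pose a i j := p + x i + x j; pose b i j := x i - x j.
(* One of the two Gaussian parameters stays fixed at [l] while the other is integrated. The boolean
   tells which argument keeps the factor [e l]; the second integration turns both halves into the
   same sum, whence the factor 2 divided out at the end. *)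
have step2 l : 0 <= l -> 0 <= \sum_(s : (I * I) * bool)
    (if s.2 then A s.1.1 s.1.2 * h (b s.1.1 s.1.2)
     else A s.1.1 s.1.2 * h (a s.1.1 s.1.2)) *
    e l (if s.2 then a s.1.1 s.1.2 else b s.1.1 s.1.2).
  move=> l0; have := @mixture_ge0 ((I * I) * bool)%type
    (fun s => A s.1.1 s.1.2 *
      e l (if s.2 then a s.1.1 s.1.2 else b s.1.1 s.1.2))
    (fun s => if s.2 then b s.1.1 s.1.2 else a s.1.1 s.1.2).
  move=> H; apply: le_trans (H _) _ => [m m0|].
    have := @posker_gauss_pair R l m p I A x pA; congr (0 <= _).
    rewrite !sum_pair; apply: eq_bigr => i _; apply: eq_bigr => j _.
    by rewrite big_bool/= /e /a /b; ring.
  rewrite le_eqVlt; apply/orP; left; apply/eqP; apply: eq_bigr => -[[i j] []] _ /=; ring.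
have := mixture_ge0 step2; rewrite !sum_pair => H.
rewrite -(pmulr_rge0 _ (ltr0n R 2)) (_ : 2%:R * _ = \sum_i \sum_j
  2%:R * (A i j * (h (a i j) * h (b i j)))).
  apply: le_trans H _.
  apply: ler_sum => i _; apply: ler_sum => j _.
  by rewrite le_eqVlt; apply/orP; left; apply/eqP; rewrite big_bool/=; ring.
by rewrite mulr_sumr; apply: eq_bigr => i _; rewrite mulr_sumr.
Qed.

Lemma mixture_even q : h (- q) = h q.
Proof. apply: EFin_inj; rewrite /h Umu [RHS]Umu.
by apply: eq_integral => l _; rewrite intrN sqrrN. Qed.

End annealed_gaussian_kernels.

(** * Unconditional sums of nonnegative terms *)

Section esum_complements.
Context {R : realType}.
Local Open Scope ereal_scope.

Lemma esum_subset (T : choiceType) (A B : set T) (f : T -> \bar R) :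
  A `<=` B -> \esum_(i in A) f i <= \esum_(i in B) f i.
Proof.
move=> AB; apply: ge_ereal_sup => _ [X [finX XA] <-]; apply: esum_ge.
by exists X => //; split => //; exact: subset_trans AB.
Qed.

Lemma esumZl (T : choiceType) (A : set T) (c : R) (f : T -> \bar R) :
  (0 <= c)%R -> (forall i, A i -> 0 <= f i) ->
  \esum_(i in A) (c%:E * f i) = c%:E * \esum_(i in A) f i.
Proof.
have half (d : R) (g : T -> \bar R) : (0 <= d)%R ->
    (forall i, A i -> 0 <= g i) ->
    \esum_(i in A) (d%:E * g i) <= d%:E * \esum_(i in A) g i.
  move=> d0 g0; apply: ge_ereal_sup => _ [X [finX XA] <-].
  rewrite fsbig_finite// big_seq -ge0_sume_distrr; last first.
    by move=> i; rewrite in_fset_set// inE => /XA /g0.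
  rewrite -big_seq -fsbig_finite// lee_wpmul2l ?lee_fin//.
  by apply: ereal_sup_ubound; exists X.
rewrite le_eqVlt => /predU1P[<- f0|c0 f0].
  by rewrite mul0e esum1// => i _; rewrite mul0e.
apply/eqP; rewrite eq_le; apply/andP; split; first by apply: half; rewrite ?ltW.
rewrite -lee_pdivlMl//.
rewrite -(@eq_esum _ _ _ (fun i => c^-1%:E * (c%:E * f i))); last first.
  by move=> i Ai; rewrite muleA -EFinM mulVf ?mul1e ?gt_eqF.
apply: half => [|i Ai]; first by rewrite invr_ge0 ltW.
by rewrite mule_ge0 ?f0// lee_fin ltW.
Qed.

Lemma esumM (S T : choiceType) (A : set S) (B : set T) (f : S -> R)
    (g : T -> R) : (forall i, 0 <= f i)%R -> (forall j, 0 <= g j)%R ->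
  \esum_(j in B) (g j)%:E < +oo ->
  \esum_(p in A `*` B) (f p.1 * g p.2)%:E =
  (\esum_(i in A) (f i)%:E) * (\esum_(j in B) (g j)%:E).
Proof.
move=> f0 g0 goo.
have gfin : \esum_(j in B) (g j)%:E \is a fin_num.
  by rewrite ge0_fin_numE// esum_ge0// => j _; rewrite lee_fin.
rewrite -(@esum_esum _ _ _ A (fun=> B) (fun i j => (f i * g j)%:E)); last first.
  by move=> i j _ _; rewrite lee_fin mulr_ge0.
rewrite -(fineK gfin) [RHS]muleC -esumZl; last 2 first.
- by apply: fine_ge0; rewrite esum_ge0// => j _; rewrite lee_fin.
- by move=> i _; rewrite lee_fin.
apply: eq_esum => i _; under eq_esum do rewrite EFinM.
rewrite esumZl//; last by move=> j _; rewrite lee_fin.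
by rewrite muleC fineK.
Qed.

Lemma esum_range (I : finType) (T : choiceType) (e : I -> T) (f : T -> R) :
  injective e -> (forall t, 0 <= f t)%R ->
  \esum_(t in range e) (f t)%:E = (\sum_i f (e i))%:E.
Proof.
move=> inje f0; rewrite esum_image; last by move=> x y _ _; exact: inje.
rewrite esum_fset; [|exact: finite_finset|by move=> i _; rewrite lee_fin].
rewrite -sumEFin fsbig_finite/=; last exact: finite_finset.
rewrite -big_enum; apply: perm_big; apply: uniq_perm.
- exact: fset_uniq.
- exact: enum_uniq.
move=> i; rewrite mem_enum in_fset_set; last exact: finite_finset.
by rewrite in_setT.
Qed.

Lemma esum_finite_pairs (T : choiceType) (B : set T) (f : T -> T -> R) :
  finite_set B -> (forall u v, 0 <= f u v)%R ->
  \esum_(p in B `*` B) (f p.1 p.2)%:E =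
  (\sum_(i : fset_set B) \sum_(j : fset_set B) f (val i) (val j))%:E.
Proof.
move=> finB f0; rewrite -(sum_pair (fun p => f (val p.1) (val p.2))).
rewrite -(@esum_range (fset_set B * fset_set B)%type _
  (fun p => (val p.1, val p.2)) (fun p => f p.1 p.2))//=; last first.
  by move=> [i j] [i' j'] [] /val_inj -> /val_inj ->.
congr esum; apply/seteqP; split => [[u v] [/= Bu Bv]|_ [[i j] _ <-]/=].
  have uB : u \in fset_set B by rewrite in_fset_set// inE.
  have vB : v \in fset_set B by rewrite in_fset_set// inE.
  by exists (FSetSub uB, FSetSub vB).
by have := valP i; have := valP j; rewrite !in_fset_set// !inE.
Qed.

(** A finite set of pairs lies in a finite square, on which the kernel can be tested with the
    all-ones matrix. Comparing on squares suffices because all terms are nonnegative. *)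
Lemma posker_esum (T : choiceType) (D : set T) (a b : T -> T -> R) :
  (forall u v, 0 <= a u v)%R -> (forall u v, 0 <= b u v)%R ->
  posker (fun u v => a u v - b u v)%R ->
  \esum_(p in D `*` D) (b p.1 p.2)%:E <= \esum_(p in D `*` D) (a p.1 p.2)%:E.
Proof.
move=> a0 b0 pab; apply: ge_ereal_sup => _ [X [finX XD] <-].
pose B := X.`1 `|` X.`2.
have finB : finite_set B.
  by rewrite finite_setU; split; [exact: finite_set_fst|exact: finite_set_snd].
have BD : B `<=` D by move=> u [[v /XD[]]|[v /XD[]]].
apply: (@le_trans _ _ (\esum_(p in B `*` B) (b p.1 p.2)%:E)).
  apply: ereal_sup_ubound; exists X => //; split => // -[u v] Xuv.
  by split; [left; exists v|right; exists u].
apply: (@le_trans _ _ (\esum_(p in B `*` B) (a p.1 p.2)%:E)); last first.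
  by apply: esum_subset => -[u v] [/BD ? /BD ?].
rewrite !esum_finite_pairs// lee_fin -subr_ge0.
have pone : psd (fun _ _ : fset_set B => 1%R : R).
  move=> c; under eq_bigr do under eq_bigr do rewrite mulr1.
  by under eq_bigr do rewrite -mulr_sumr; rewrite -mulr_suml -expr2 sqr_ge0.
have := pab _ _ val pone; congr (0 <= _)%R.
rewrite -sumrB; apply: eq_bigr => i _; rewrite -sumrB; apply: eq_bigr => j _.
by rewrite mul1r.
Qed.

End esum_complements.

(** * Ginibre's inequality for integer fields *)

Section correlation_inequality.
Context {R : realType} {V : choiceType}.
Implicit Types (u v p n m : config V) (K Y : set V) (W F H : config V -> R).

Definition conf0 : config V := fun=> 0.
Definition confN u : config V := fun x => - u x.
Definition confB u v : config V := fun x => u x - v x.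
Definition confD u v : config V := fun x => u x + v x.

Definition supported_in K : set (config V) :=
  [set n | forall x, ~ K x -> n x = 0].

Definition mass K F : \bar R := (\esum_(n in supported_in K) (F n)%:E)%E.

(** [confD (confD p u) v] and [confB u v] stand for the two copies [n] and [m] of the field, so that
    [n - m = p + 2v]; in the application [p] is the parity of [n - m]. *)
Definition pair_positive W :=
  forall p, posker (fun u v => W (confD (confD p u) v) * W (confB u v)).

Definition difference_positive F :=
  forall p, posker (fun u v => F (confB u v) - F (confD (confD p u) v)).

Definition positive_definite F := posker (fun u v => F (confB u v)).

(** Pull [F (confB u v)] back along the identity minus the reflection sending [u] to [- (p + u)].
    For even [F] the four resulting terms coincide in pairs, and half of their sum is the required
    difference. *)
Lemma even_positive_definite F : (forall u, F (confN u) = F u) ->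
  positive_definite F -> difference_positive F.
Proof.
move=> evenF pF p.
have := poskerZ (_ : 0 <= 2^-1) (posker_double (fun b : bool => (-1) ^+ b)
  (fun b u => if b then confN (confD p u) else u) pF).
rewrite invr_ge0 ler0n => /(_ isT); apply: posker_ext => u v.
rewrite !big_bool/= !expr1 !expr0.
have -> : confB (confN (confD p u)) (confN (confD p v)) = confN (confB u v).
  by apply/funext => x; rewrite /confB /confN /confD; lia.
have -> : confB (confN (confD p u)) v = confN (confD (confD p u) v).
  by apply/funext => x; rewrite /confB /confN /confD; lia.
have -> : confB u (confN (confD p v)) = confD (confD p u) v.
  by apply/funext => x; rewrite /confB /confN /confD; lia.
by rewrite !evenF; field.
Qed.

Lemma mass_ge0 K F : (forall n, 0 <= F n) -> (0 <= mass K F)%E.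
Proof. by move=> F0; apply: esum_ge0 => n _; rewrite lee_fin. Qed.

(** Division of [n - m] by 2 has the remainder [p] and the quotient [v], and [u = m + v];
    restricting [p] to the values 0 and 1 makes the change of variables bijective on integer
    configurations. *)
Let parity_pairs K : set (config V * (config V * config V)) :=
  [set p | supported_in K p /\ forall x, p x = 0 \/ p x = 1] `*`
  (supported_in K `*` supported_in K).

Let parity_bij K : set_bij (parity_pairs K)
  (supported_in K `*` supported_in K)
  (fun t => (confD (confD t.1 t.2.1) t.2.2, confB t.2.1 t.2.2)).
Proof.
split.
- move=> [p [u v]] [/= [Kp _] [Ku Kv]]; split => /= x Kx.
    by rewrite /confD Kp// Ku// Kv.
  by rewrite /confB Ku// Kv.
- move=> [p [u v]] [p' [u' v']]; rewrite !inE/= => -[/= [_ P] _] [/= [_ P'] _] [].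
  move=> /funeqP E1 /funeqP E2.
  suff H x : p x = p' x /\ u x = u' x /\ v x = v' x.
    by congr (_, (_, _)); apply/funext => x; have [? [? ?]] := H x.
  move: (P x) (P' x) (E1 x) (E2 x); rewrite /confD /confB; lia.
- move=> [n m] [/= Kn Km].
  pose v : config V := fun x => ((n x - m x) %/ 2)%Z.
  pose p : config V := fun x => ((n x - m x) %% 2)%Z.
  exists (p, (confD m v, v)).
    split; [split => [x Kx|x] | split => x Kx] => /=.
    + by rewrite /p Kn// Km.
    + by rewrite /p; lia.
    + by rewrite /confD /v Km// Kn.
    + by rewrite /v Km// Kn.
  by congr (_, _); apply/funext => x; rewrite /confB /confD /p /v /=; lia.
Qed.

(* Ginibre's inequality: in the variables [p + u + v] and [u - v] the symmetrized
   covariance is a sum of values of a positive kernel. *)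
Lemma mass_correlation K W F H :
  (forall n, 0 <= W n) -> (forall n, 0 <= F n) -> (forall n, 0 <= H n) ->
  pair_positive W -> difference_positive F -> difference_positive H ->
  (mass K W < +oo)%E ->
  (mass K (fun n => W n * F n)%R < +oo)%E ->
  (mass K (fun n => W n * H n)%R < +oo)%E ->
  (mass K (fun n => W n * (F n * H n))%R < +oo)%E ->
  (mass K (fun n => W n * F n)%R * mass K (fun n => W n * H n)%R <=
   mass K W * mass K (fun n => W n * (F n * H n))%R)%E.
Proof.
move=> W0 F0 H0 pW pF pH Wfin WFfin WHfin WFHfin.
have WF0 n : 0 <= W n * F n by rewrite mulr_ge0.
have WH0 n : 0 <= W n * H n by rewrite mulr_ge0.
have WFH0 n : 0 <= W n * (F n * H n) by rewrite mulr_ge0// mulr_ge0.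
pose D := supported_in K.
(* [a n m - b n m = W n * W m * (F n - F m) * (H n - H m)]. The two signs are kept apart so that
   each sum has nonnegative terms. *)
pose a n m := W n * (W m * (F m * H m)) + W n * (F n * H n) * W m.
pose b n m := W n * F n * (W m * H m) + W n * H n * (W m * F m).
have a0 n m : 0 <= a n m by rewrite addr_ge0// mulr_ge0.
have b0 n m : 0 <= b n m by rewrite addr_ge0// mulr_ge0.
have ba : (\esum_(p in D `*` D) (b p.1 p.2)%:E <=
           \esum_(p in D `*` D) (a p.1 p.2)%:E)%E.
  rewrite !(reindex_esum _ _ _ _ (parity_bij K))/=.
  rewrite -(@esum_esum _ _ _ _ (fun=> D `*` D) (fun p t =>
    (b (confD (confD p t.1) t.2) (confB t.1 t.2))%:E))/=; last first.
    by move=> p t _ _; rewrite lee_fin.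
  rewrite -(@esum_esum _ _ _ _ (fun=> D `*` D) (fun p t =>
    (a (confD (confD p t.1) t.2) (confB t.1 t.2))%:E))/=; last first.
    by move=> p t _ _; rewrite lee_fin.
  apply: le_esum => p _; apply: (posker_esum D
    (a := fun u v => a (confD (confD p u) v) (confB u v))
    (b := fun u v => b (confD (confD p u) v) (confB u v))) => //.
  apply: posker_ext (poskerM (pW p) (poskerM (pF p) (pH p))) => u v.
  by rewrite /a /b; ring.
have fin f : (forall n, 0 <= f n) -> (mass K f < +oo)%E ->
    mass K f \is a fin_num.
  by move=> f0 foo; rewrite ge0_fin_numE// mass_ge0.
move: ba; rewrite /a /b.
under eq_esum do rewrite EFinD.
rewrite esumD; [|by move=> i _; rewrite lee_fin mulr_ge0..].
under [in X in (_ <= X)%E]eq_esum do rewrite EFinD.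
rewrite esumD; [|by move=> i _; rewrite lee_fin mulr_ge0..].
rewrite (@esumM _ _ _ D D (fun n => W n * F n)%R (fun n => W n * H n)%R)//.
rewrite (@esumM _ _ _ D D (fun n => W n * H n)%R (fun n => W n * F n)%R)//.
rewrite (@esumM _ _ _ D D (fun n => W n)%R (fun n => W n * (F n * H n))%R)//.
rewrite (@esumM _ _ _ D D (fun n => W n * (F n * H n))%R (fun n => W n)%R)//.
rewrite -!/(mass K _).
move: (fin _ W0 Wfin) (fin _ WF0 WFfin) (fin _ WH0 WHfin) (fin _ WFH0 WFHfin).
move=> /fineK <- /fineK <- /fineK <- /fineK <-.
rewrite -!EFinM -!EFinD !lee_fin.
move: (fine _) (fine _) (fine _) (fine _) => x y z t; lra.
Qed.

End correlation_inequality.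

(** * Averaging positive definite functions over large boxes *)

Section folner_averaging.
Context {R : realType} {V : choiceType}.
Implicit Types (K : set V) (F : config V -> R).

Lemma ler_bernoulli (x : R) k : 0 <= x <= 1 -> 1 - x *+ k <= (1 - x) ^+ k.
Proof.
move=> /andP[x0 x1]; elim: k => [|k IH]; first by rewrite mulr0n subr0.
rewrite exprS; apply: (@le_trans _ _ ((1 - x) * (1 - x *+ k))); last first.
  by rewrite ler_wpM2l// subr_ge0.
rewrite mulrS; have : 0 <= x * (x *+ k) by rewrite mulr_ge0// mulrn_wge0.
by set z := x *+ k; nra.
Qed.

Lemma sum_geometric_le (r : R) n : 0 <= r -> r < 1 ->
  \sum_(i < n) r ^+ i <= (1 - r)^-1.
Proof.
move=> r0 r1; rewrite -[leRHS]mul1r ler_pdivlMr ?subr_gt0// mulrC.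
have -> : (1 - r) * \sum_(i < n) r ^+ i = 1 - r ^+ n.
  by rewrite -opprB mulNr -subrX1 opprB.
by rewrite lerBlDr lerDl exprn_ge0.
Qed.

Section box.
Variable K : set V.
Hypothesis finK : finite_set K.

Definition conf_of_ffun (g : {ffun fset_set K -> int}) : config V :=
  fun x => if insub x is Some i then g i else 0.

Lemma conf_of_ffunE g (i : fset_set K) : conf_of_ffun g (val i) = g i.
Proof. by rewrite /conf_of_ffun valK. Qed.

Lemma conf_of_ffun_supported g : supported_in K (conf_of_ffun g).
Proof.
move=> x Kx; rewrite /conf_of_ffun insubN//.
by rewrite in_fset_set//; apply/negP; rewrite inE.
Qed.

Lemma conf_of_ffun_inj : injective conf_of_ffun.
Proof.
move=> g g' gg'; apply/ffunP => i.
by rewrite -!conf_of_ffunE gg'.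
Qed.

Lemma supported_inP n : supported_in K n -> exists g, n = conf_of_ffun g.
Proof.
move=> Kn; exists [ffun i => n (val i)]; apply/funext => x.
have [Kx|Kx] := pselect (K x); last by rewrite Kn// conf_of_ffun_supported.
have xK : x \in fset_set K by rewrite in_fset_set// inE.
by rewrite -[x]/(val (FSetSub xK)) conf_of_ffunE ffunE.
Qed.

Lemma supported_in_eqP n m : supported_in K n -> supported_in K m ->
  (forall i : fset_set K, n (val i) = m (val i)) -> n = m.
Proof.
move=> /supported_inP[g ->] /supported_inP[g' ->] gg'.
by congr conf_of_ffun; apply/ffunP => i; have := gg' i; rewrite !conf_of_ffunE.
Qed.


Let box N (g : {ffun fset_set K -> 'I_N}) :=
  conf_of_ffun [ffun i => (g i : nat)%:Z].

Let box_inj N : injective (@box N).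
Proof.
move=> g g' /conf_of_ffun_inj /ffunP gg'; apply/ffunP => i.
by have := gg' i; rewrite !ffunE => -[] /val_inj.
Qed.

Let confB_inj (u : config V) : injective (confB u).
Proof.
move=> v v' /funeqP uv; apply/funext => x.
by have := uv x; rewrite /confB; lia.
Qed.

(* Positivity on the box {0, ..., N - 1}^K, divided by the volume of the box:
   for large N most points of the box see the whole of any given finite set. *)
Lemma positive_definite_mass_le (a b : config V -> R) :
  (forall n, 0 <= a n) -> (forall n, 0 <= b n) ->
  posker (fun u v => a (confB u v) - b (confB u v)) ->
  (mass K b <= mass K a)%E.
Proof.
move=> a0 b0 pab; have [aoo|afin] := eqVneq (mass K a) +oo%E.
  by rewrite aoo leey.
have {}afin : mass K a \is a fin_num by rewrite ge0_fin_numE ?mass_ge0// ltey.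
set s := fine (mass K a).
apply: ge_ereal_sup => _ [X [finX XK] <-].
rewrite fsbig_finite// sumEFin -(fineK afin) lee_fin -/s.
set t := \sum_(n <- _) _; have t0 : 0 <= t by exact: sumr_ge0.
(* A crude common bound for all heights occurring in the finite family [X]. *)
pose J := (\sum_(n <- fset_set X) \sum_(i : fset_set K) `|n (val i)|)%N.
have XJ n (i : fset_set K) : X n -> (`|n (val i)| <= J)%N.
  move=> Xn; rewrite /J (big_fsetD1 n)/=; last by rewrite in_fset_set ?inE.
  by rewrite (bigD1 i)//= -addnA leq_addr.
pose k := #|{: fset_set K}|.
(* The box has side [N = M + 2J]. Its points with coordinates from [J] to [J + M - 1], [M ^ k] in
   number, reach every configuration of [X] by subtracting a point of the box, so each contributes
   at least [t] for [b]; each of the [N ^ k] points contributes at most [s] for [a]. *)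
have key M : t * (M ^ k)%:R <= s * ((M + (J + J)) ^ k)%:R.
  set N := (M + (J + J))%N.
  have psd1 : psd (fun _ _ : {ffun fset_set K -> 'I_N} => 1 : R).
    move=> c; under eq_bigr do under eq_bigr do rewrite mulr1.
    by under eq_bigr do rewrite -mulr_sumr; rewrite -mulr_suml -expr2 sqr_ge0.
  have inj u : injective (fun v => confB (@box N u) (@box N v)).
    by move=> v v' /confB_inj /box_inj.
  have upper u : \sum_v a (confB (@box N u) (@box N v)) <= s.
    rewrite -lee_fin -(esum_range (e := fun v => confB (@box N u) (@box N v)))//.
    rewrite fineK//; apply: esum_subset => _ [v _ <-] x Kx.
    by rewrite /confB /box !conf_of_ffun_supported.
  have Jlt (j : 'I_M) : (j + J < N)%N by rewrite /N; have := ltn_ord j; lia.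
  pose shift (g : {ffun fset_set K -> 'I_M}) := [ffun i => Ordinal (Jlt (g i))].
  have shift_inj : injective shift.
    move=> g g' /ffunP gg'; apply/ffunP => i.
    by have := gg' i; rewrite !ffunE => -[] /addIn /val_inj.
  have lower g : t <= \sum_v b (confB (@box N (shift g)) (@box N v)).
    rewrite -lee_fin -(esum_range (e := fun v => confB (@box N (shift g)) (@box N v)))//.
    rewrite /t -sumEFin -fsbig_finite//; apply: ereal_sup_ubound; exists X => //.
    split => // n Xn.
    have lt i : (`|(g i + J)%:Z - n (val i)| < N)%N.
      have := ltn_ord (g i); have := XJ _ i Xn; rewrite /N.
      by move: (n _) (nat_of_ord _) => z c; lia.
    exists [ffun i => Ordinal (lt i)] => //; apply: supported_in_eqP.
    - by move=> x Kx; rewrite /confB /box !conf_of_ffun_supported.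
    - exact: XK.
    - move=> i; rewrite /confB /box !conf_of_ffunE !ffunE/=.
      by have := XJ _ i Xn; move: (n _) (nat_of_ord _) => z c; lia.
  have cardE L : #|{: {ffun fset_set K -> 'I_L}}| = (L ^ k)%N.
    by rewrite card_ffun card_ord.
  rewrite mulr_natr -[(M ^ k)%N]cardE -sumr_const.
  rewrite mulr_natr -[(N ^ k)%N]cardE -sumr_const.
  apply: (@le_trans _ _ (\sum_u \sum_v b (confB (@box N u) (@box N v)))).
    apply: (@le_trans _ _ (\sum_(u in (shift @: predT)%SET)
        \sum_v b (confB (@box N u) (@box N v)))).
      rewrite big_imset/=; last by move=> g g' _ _ /shift_inj.
      rewrite [leRHS](eq_bigl xpredT); last by move=> g; rewrite inE.
      by apply: ler_sum => g _; exact: lower.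
    by rewrite [leRHS](bigID (mem (shift @: predT)%SET))/= lerDl;
      do 2![apply: sumr_ge0 => ? _].
  apply: (@le_trans _ _ (\sum_u \sum_v a (confB (@box N u) (@box N v)))).
    rewrite -subr_ge0 -sumrB; have := pab _ _ (@box N) psd1; congr (0 <= _).
    by apply: eq_bigr => u _; rewrite -sumrB; apply: eq_bigr => v _; rewrite mul1r.
  by apply: ler_sum => u _; exact: upper.
rewrite leNgt; apply/negP => st.
have s0 : 0 <= s by rewrite fine_ge0// mass_ge0.
(* Bernoulli's inequality makes the ratio [(M / N) ^ k] at least [1 - 2 J k / N], so that [s < t]
   would bound [M]. *)
have bound M : (0 < M)%N -> (t - s) * M%:R <= t * (J + J)%:R *+ k.
  move=> M0; pose y : R := (J + J)%:R / (M + (J + J))%:R.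
  have MJ0 : 0 < (M + (J + J))%:R :> R by rewrite ltr0n; lia.
  have y01 : 0 <= y <= 1.
    by rewrite divr_ge0//= ler_pdivrMr// mul1r ler_nat leq_addl.
  have := ler_bernoulli k y01.
  have -> : 1 - y = M%:R / (M + (J + J))%:R.
    by rewrite /y; field; rewrite -!natrD gt_eqF.
  rewrite expr_div_n => B.
  have : t * (1 - y *+ k) <= s.
    apply: le_trans (ler_wpM2l t0 B) _; rewrite mulrA ler_pdivrMr ?exprn_gt0//.
    by have := key M; rewrite !natrX.
  move=> H; have : (t - s) * (M + (J + J))%:R <= t * (J + J)%:R *+ k.
    have -> : t * (J + J)%:R *+ k = t * (y *+ k) * (M + (J + J))%:R.
      by rewrite -[RHS]mulrA mulrnAl divfK ?gt_eqF// [RHS]mulrnAr.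
    by rewrite ler_pM2r// lerBlDr addrC -lerBlDr -{1}(mulr1 t) -mulrBr.
  apply: le_trans; apply: ler_wpM2l; first by rewrite subr_ge0 ltW.
  by rewrite ler_nat leq_addr.
have ts : 0 < t - s by rewrite subr_gt0.
pose M := (Num.bound (t * (J + J)%:R *+ k / (t - s))).+1.
have := bound M isT; rewrite -ler_pdivlMl// mulrC leNgt => /negP; apply.
by rewrite /M; apply: lt_le_trans (archi_boundP _) _ => //;
  rewrite ?ler_nat// divr_ge0 ?mulrn_wge0 ?mulr_ge0// ltW.
Qed.

End box.
End folner_averaging.

(** * The algebra of cylinder events and its compactness property *)

Section cylinder_algebra.
Context {V : choiceType}.
Implicit Types (Y : set V) (A B : set (config V)).

Definition determined_by Y A :=
  forall n n', (forall x, Y x -> n x = n' x) -> A n -> A n'.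

Definition cylinder_event A := exists2 Y, finite_set Y & determined_by Y A.

Definition agree Y (a : config V) : set (config V) :=
  [set n | forall x, Y x -> n x = a x].

Lemma determined_by_agree Y a : determined_by Y (agree Y a).
Proof. by move=> n n' nn' na x Yx; rewrite -nn'// na. Qed.

Lemma cylinder_event0 : cylinder_event set0.
Proof. by exists set0. Qed.

Lemma cylinder_eventC A : cylinder_event A -> cylinder_event (~` A).
Proof.
move=> [Y finY AY]; exists Y => // n n' nn' An An'; apply: An.
by apply: AY An' => x /nn'.
Qed.

Lemma cylinder_eventU A B : cylinder_event A -> cylinder_event B ->
  cylinder_event (A `|` B).
Proof.
move=> [Y finY AY] [Z finZ BZ]; exists (Y `|` Z); first by rewrite finite_setU.
by move=> n n' nn' [An|Bn]; [left; apply: AY An|right; apply: BZ Bn] => x ?;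
  apply: nn'; [left|right].
Qed.

Lemma cylinder_eventI A B : cylinder_event A -> cylinder_event B ->
  cylinder_event (A `&` B).
Proof.
move=> cA cB; rewrite -[A]setCK -[B]setCK -setCU.
by apply: cylinder_eventC; apply: cylinder_eventU; exact: cylinder_eventC.
Qed.

Lemma cylinder_event_bigsetU (F : nat -> set (config V)) N :
  (forall i, cylinder_event (F i)) -> cylinder_event (\big[setU/set0]_(i < N) F i).
Proof.
move=> cF; elim/big_ind: _ => //; first exact: cylinder_event0.
exact: cylinder_eventU.
Qed.

(** A second copy of the configurations, whose measurable sets are the cylinder events: they form
    the algebra of sets from which the extension of the content starts. *)
Definition cylinder_space (W : choiceType) : Type := config W.

End cylinder_algebra.

HB.instance Definition _ (V : choiceType) := Pointed.on (cylinder_space V).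
HB.instance Definition _ (V : choiceType) :=
  isAlgebraOfSets.Build default_measure_display (cylinder_space V)
    (@cylinder_event0 V) (@cylinder_eventU V) (@cylinder_eventC V).

Lemma finite_absz_le (m : nat) : finite_set [set z : int | (`|z| <= m)%N].
Proof.
apply: (@sub_finite_set _ _ [set (i%:Z - m%:Z)%R | i in `I_(m + m).+1]).
  by move=> z /= zm; exists (`|(z + m%:Z)%R|%N); rewrite /=; lia.
by apply: finite_image; exact: finite_II.
Qed.

(** Compactness: the heights are confined to the finite windows given by [M], so Tychonoff's theorem
    provides the witnesses with a cluster point. A neighborhood of it fixes the coordinates in
    [Y i], hence some witness of index [k >= i] agrees with it there and puts it in [C i]. *)
Lemma decreasing_cylinders_nonempty (V : choiceType) (M : V -> nat)
    (C : nat -> set (config V)) (Y : nat -> set V) :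
  (forall i j, (i <= j)%N -> C j `<=` C i) ->
  (forall i, determined_by (Y i) (C i)) -> (forall i, finite_set (Y i)) ->
  (forall i, exists n, C i n /\ forall x, Y i x -> (`|n x| <= M x)%N) ->
  \bigcap_i C i !=set0.
Proof.
move=> dC CY finY /choice[w wP].
pose T := fun _ : V => discrete_topology int.
pose Q x : set (T x) := [set z : int | (`|z| <= M x)%N].
have cptQ x : compact (Q x) by apply: finite_compact; exact: finite_absz_le.
(* Erasing the witness outside of [Y i] keeps it in [C i] and brings all its coordinates into the
   windows. *)
pose w' i : forall x, T x := fun x => if `[< Y i x >] then w i x else 0.
have w'Q i : [set f : forall x, T x | forall x, Q x (f x)] (w' i).
  move=> x; rewrite /w' /Q/=; case: asboolP => [Yx|_]; last by rewrite absz0.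
  exact: (wP i).2.
have Cw' i : C i (w' i).
  by apply: CY (wP i).1 => x Yx; rewrite /w' asboolT.
have Pw' : ProperFilter (w' @ \oo) by exact: fmap_proper_filter.
have Qw' : (w' @ \oo) [set f : forall x, T x | forall x, Q x (f x)].
  by exists 0%N => // i _; exact: w'Q.
have [f [_ clf]] := tychonoff cptQ Pw' Qw'.
exists f => i _.
have nf : nbhs f [set g : forall x, T x | forall x, Y i x -> g x = f x].
  have -> : [set g : forall x, T x | forall x, Y i x -> g x = f x] =
      \bigcap_(x in [set` fset_set (Y i)])
        (proj x @^-1` [set f x] : set (forall x, T x)).
    by apply/seteqP; split => g /= gf x; rewrite ?fset_setK//= => Yx;
      apply: gf; rewrite ?fset_setK.
  apply: filter_bigI => x _.
  by apply: (@proj_continuous _ T x f); exact: discrete_set1.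
have wi : (w' @ \oo) [set w' k | k in [set k | (i <= k)%N]].
  by exists i => // k /= ik; exists k.
have [_ [[k /= ik <-] kf]] := clf _ _ wi nf.
by apply: CY (dC _ _ ik _ (Cw' k)) => x /kf.
Qed.

(** * Kolmogorov's extension of a tight content *)

Section cylinder_extension.
Context {R : realType} {V : choiceType}.
Variable m : set (config V) -> R.
Hypothesis m_ge0 : forall A, 0 <= m A.
Hypothesis m_setT : m setT = 1.
Hypothesis m_setU : forall A B, cylinder_event A -> cylinder_event B ->
  A `&` B = set0 -> m (A `|` B) = m A + m B.
Hypothesis m_tight : forall x e, 0 < e ->
  exists J, m [set n | (J < `|n x|)%N] <= e.
Hypothesis V_countable : countable [set: V].

Definition cylinder_content (A : set (cylinder_space V)) : \bar R := (m A)%:E.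

Let m0 : m set0 = 0.
Proof.
have := m_setU (@cylinder_event0 V) (@cylinder_event0 V) (setI0 _).
by rewrite setU0 => /eqP; rewrite eq_sym -subr_eq0 addrK => /eqP.
Qed.

Let content_ge0 A : (0 <= cylinder_content A)%E.
Proof. by rewrite lee_fin. Qed.

Let content_semi_additive : measure_function.semi_additive cylinder_content.
Proof.
move=> F n mF tF _; elim: n => [|n IH].
  by rewrite !big_ord0 /cylinder_content m0.
rewrite big_ord_recr [RHS]big_ord_recr/= -IH /cylinder_content -EFinD.
congr EFin; apply: m_setU.
- exact: cylinder_event_bigsetU.
- exact: mF.
- rewrite -bigcup_mkord; apply/seteqP; split => // w [[i /= ij Fi] Fn].
  by have /eqP := tF i n I I (ex_intro _ w (conj Fi Fn)); rewrite ltn_eqF.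
Qed.

HB.instance Definition _ := isContent.Build _ (cylinder_space V) R
  cylinder_content content_ge0 content_semi_additive.

Let mS A B : cylinder_event A -> cylinder_event B -> A `<=` B -> m A <= m B.
Proof.
move=> cA cB AB.
have -> : B = A `|` (B `&` ~` A).
  by rewrite -setDE setDUK.
rewrite m_setU ?lerDl//; last by rewrite setICA setICr setI0.
by apply: cylinder_eventI => //; exact: cylinder_eventC.
Qed.

Let m_le A B D : cylinder_event A -> cylinder_event B -> cylinder_event D ->
  A `<=` B `|` D -> m A <= m B + m D.
Proof.
move=> cA cB cD ABD.
apply: (@le_trans _ _ (m (B `|` (D `&` ~` B)))).
  apply: mS => //.
    apply: cylinder_eventU => //; apply: cylinder_eventI => //.
    exact: cylinder_eventC.
  by move=> n /ABD[Bn|Dn]; [left|have [Bn|Bn] := pselect (B n); [left|right]].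
have cDB : cylinder_event (D `&` ~` B).
  by apply: cylinder_eventI => //; exact: cylinder_eventC.
rewrite m_setU//; last by rewrite setICA setICr setI0.
by rewrite lerD2l; apply: mS => // n [].
Qed.

Let m_cover (I : eqType) (s : seq I) (A : set (config V))
    (D : I -> set (config V)) : cylinder_event A ->
  (forall i, cylinder_event (D i)) ->
  (forall n, A n -> exists2 i, i \in s & D i n) ->
  m A <= \sum_(i <- s) m (D i).
Proof.
move=> cA cD; elim: s A cA => [|j s IH] A cA AD.
  rewrite big_nil (_ : A = set0) ?m0//.
  by apply/seteqP; split => // n /AD[].
rewrite big_cons; apply: le_trans (lerD (lexx _) (IH (A `&` ~` D j) _ _)).
- apply: m_le => //.
    by apply: cylinder_eventI => //; exact: cylinder_eventC.
  by move=> n An; have [Dn|Dn] := pselect (D j n); [left|right].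
- by apply: cylinder_eventI => //; exact: cylinder_eventC.
- move=> n [/AD[i]]; rewrite inE => /predU1P[->//|si Di _].
  by exists i.
Qed.

Let sum_half_pow (s : seq nat) : uniq s ->
  \sum_(k <- s) (2^-1 : R) ^+ k.+2 <= 2^-1.
Proof.
move=> us; pose N := (\max_(k <- s) k).+1.
have sN k : k \in s -> (k < N)%N by move=> ks; rewrite ltnS leq_bigmax_seq.
apply: (@le_trans _ _ (\sum_(k <- iota 0 N) (2^-1 : R) ^+ k.+2)).
  have pe : perm_eq [seq k <- iota 0 N | k \in s] s.
    apply: uniq_perm; rewrite ?filter_uniq ?iota_uniq// => k.
    rewrite mem_filter mem_iota add0n leq0n.
    by case: (boolP (k \in s)) => //= /sN ->.
  rewrite [leRHS](bigID (mem s)) -[X in _ <= X + _]big_filter (perm_big _ pe).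
  by rewrite lerDl; apply: sumr_ge0 => k _; rewrite exprn_ge0.
have -> : iota 0 N = index_iota 0 N by rewrite /index_iota subn0.
rewrite big_mkord; under eq_bigr do rewrite !exprS mulrA.
rewrite -mulr_sumr.
have := @sum_geometric_le R (2^-1) N (ltW _) _; rewrite invr_gt0 ltr0n.
rewrite invf_lt1 ?ltr1n// => /(_ isT isT).
have -> : (1 - 2^-1)^-1 = 2 :> R by field.
by move: (\sum_(_ < _) _) => z; lra.
Qed.

(** Tightness replaces compactness: the window at [x] loses at most [e / 2 ^ (idx x + 2)], all
    windows together at most [e / 2], so no [C i] can lie in the part lost. *)
Let m_cap_nonempty (C : nat -> set (config V)) (e : R) : 0 < e ->
  (forall i j, (i <= j)%N -> C j `<=` C i) ->
  (forall i, cylinder_event (C i)) -> (forall i, e <= m (C i)) ->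
  \bigcap_i C i !=set0.
Proof.
move=> e0 dC cC eC.
have /countable_injP[idx idxP] := V_countable.
have /choice[Y YP] : forall i, exists Y, finite_set Y /\ determined_by Y (C i).
  by move=> i; have [Y finY CY] := cC i; exists Y.
have /choice[M MP] : forall x, exists J,
    m [set n | (J < `|n x|)%N] <= e * 2^-1 ^+ (idx x).+2.
  by move=> x; apply: m_tight; rewrite mulr_gt0// exprn_gt0// invr_gt0.
have ctail x : cylinder_event [set n : config V | (M x < `|n x|)%N].
  by exists [set x]; [exact: finite_set1|move=> n n' /= <-].
apply: (decreasing_cylinders_nonempty (M := M) (Y := Y) dC) => i.
- exact: (YP i).2.
- exact: (YP i).1.
apply: contrapT => noC.
have : m (C i) <= \sum_(x <- fset_set (Y i)) m [set n | (M x < `|n x|)%N].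
  apply: m_cover => // n Cn; apply: contrapT => nx; apply: noC; exists n.
  split => // x Yx; rewrite leqNgt; apply/negP => Mx; apply: nx; exists x => //.
  by rewrite in_fset_set ?inE//; exact: (YP i).1.
apply/negP; rewrite -ltNge; apply: lt_le_trans (eC i).
apply: (@le_lt_trans _ _ (\sum_(x <- fset_set (Y i)) e * 2^-1 ^+ (idx x).+2)).
  by apply: ler_sum => x _; exact: MP.
rewrite -mulr_sumr -(big_map idx xpredT (fun k => 2^-1 ^+ k.+2)).
apply: (@le_lt_trans _ _ (e * 2^-1)); last by rewrite gtr_pMr// invf_lt1 ?ltr1n.
rewrite ler_pM2l//; apply: sum_half_pow.
by rewrite map_inj_in_uniq ?fset_uniq// => x y _ _; apply: idxP; rewrite inE.
Qed.

(** If subadditivity failed by [e], the sets [A] minus the first [N] of the [F i] would decrease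
    with content at least [e], and a common point would lie in [A] but in no [F i]. *)
Let content_sigma_subadditive :
  measurable_subset_sigma_subadditive cylinder_content.
Proof.
move=> A F mF mA AF; rewrite leNgt; apply/negP => lt.
set s := (\sum_(n <oo) cylinder_content (F n))%E in lt.
have s0 : (0 <= s)%E by apply: nneseries_ge0 => n _ _; rewrite lee_fin.
have sfin : s \is a fin_num.
  by rewrite ge0_fin_numE//; apply: lt_trans lt _; rewrite ltry.
pose e := m A - fine s.
have e0 : 0 < e by rewrite subr_gt0 -lte_fin fineK.
pose C N : set (config V) := A `&` ~` (\big[setU/set0]_(i < N) F i).
have cC N : cylinder_event (C N).
  apply: cylinder_eventI => //; apply: cylinder_eventC.
  exact: cylinder_event_bigsetU.
have [||n Cn] := @m_cap_nonempty C e e0 _ cC.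
- move=> i j ij n [An nF]; split => // Fi; apply: nF; move: Fi.
  by rewrite -!bigcup_mkord => -[k /= ki Fk]; exists k => //=; exact: leq_trans ij.
- move=> N; rewrite /e lerBlDr.
  have : m A <= m (C N) + m (\big[setU/set0]_(i < N) F i).
    apply: m_le => //; first exact: cylinder_event_bigsetU.
    by move=> n An; have [H|H] := pselect ((\big[setU/set0]_(i < N) F i) n);
      [right|left].
  move/le_trans; apply; rewrite lerD2l.
  apply: (@le_trans _ _ (\sum_(i <- enum 'I_N) m (F i))).
    apply: m_cover => [|i|n]; [exact: cylinder_event_bigsetU|exact: mF|].
    rewrite -bigcup_mkord => -[k /= kN Fk].
    by exists (Ordinal kN) => //; rewrite mem_enum.
  rewrite -lee_fin fineK// -sumEFin big_enum/=.
  rewrite -(big_mkord xpredT (fun i => (m (F i))%:E)).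
  by apply: nneseries_lim_ge => k _ _; rewrite lee_fin.
have [An _] := Cn 0%N I; have [k _ Fk] := AF _ An.
have [_] := Cn k.+1 I; apply; rewrite -bigcup_mkord.
by exists k => //=.
Qed.

HB.instance Definition _ := Content_SigmaSubAdditive_isMeasure.Build _ R
  (cylinder_space V) cylinder_content content_sigma_subadditive.

Let extension : set (config V) -> \bar R := measure_extension cylinder_content.

Let measurable_cylinder_space (A : set (config V)) : measurable A ->
  <<s @measurable _ (cylinder_space V) >> A.
Proof.
apply: sub_sigma_algebra2 => _ [x [k [_ ->]]].
by exists [set x]; [exact: finite_set1|move=> n n' /= <-].
Qed.

Let extension0 : extension set0 = 0%E.
Proof. exact: measure0. Qed.

Let extension_ge0 A : (0 <= extension A)%E.
Proof. exact: measure_ge0. Qed.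

Let extension_semi_sigma_additive : semi_sigma_additive extension.
Proof.
move=> F mF tF mUF; apply: (@measure_semi_sigma_additive _ _ _
  (measure_extension cylinder_content) F) => //.
- by move=> i; exact: measurable_cylinder_space.
- exact: measurable_cylinder_space.
Qed.

HB.instance Definition _ := isMeasure.Build _ (config V) R extension
  extension0 extension_ge0 extension_semi_sigma_additive.

Let extensionE (A : set (config V)) : cylinder_event A ->
  extension A = (m A)%:E.
Proof.
move=> cA; rewrite /extension /measure_extension.
exact: (@measurable_mu_extE _ R (cylinder_space V) cylinder_content).
Qed.

Let extension_setT : extension setT = 1%E.
Proof.
rewrite extensionE ?m_setT//; exists set0; first exact: finite_set0.
by [].
Qed.

HB.instance Definition _ :=
  Measure_isProbability.Build _ _ _ extension extension_setT.

Lemma cylinder_extension : exists P : probability (config V) R,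
  forall A, cylinder_event A -> P A = (m A)%:E.
Proof. by exists extension. Qed.

End cylinder_extension.

(** * Cylinder events and the product sigma-algebra *)

Section cylinder_measurability.
Context {V : choiceType}.
Implicit Types (Y : set V) (A : set (config V)).

(** There are countably many integer patterns on the finite set [Y], and [A] is the union of those
    [agree Y a] that it contains. The family [G] is left free because it will also be one that
    contains [agree Y a] only for large [Y]. *)
Lemma determined_by_sigma (G : set (set (config V))) Y A : finite_set Y ->
  determined_by Y A -> (forall a, <<s G >> (agree Y a)) -> <<s G >> A.
Proof.
move=> finY AY GY.
pose F (k : nat) : set (config V) :=
  if (choice.unpickle k : option {ffun fset_set Y -> int}) is Some g then
    if `[< A (conf_of_ffun g) >] then agree Y (conf_of_ffun g) else set0
  else set0.
have -> : A = \bigcup_k F k.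
  apply/seteqP; split => [n An|n [k _]]; last first.
    rewrite /F; case: choice.unpickle => [g|//]; case: asboolP => // Ag ng.
    by apply: AY Ag => x /ng.
  pose g : {ffun fset_set Y -> int} := [ffun i => n (val i)].
  have gn : agree Y (conf_of_ffun g) n.
    move=> x Yx; have xY : x \in fset_set Y by rewrite in_fset_set// inE.
    by rewrite -[x]/(val (FSetSub xY)) conf_of_ffunE ffunE.
  exists (choice.pickle g) => //; rewrite /F choice.pickleK asboolT//.
  by apply: AY An => x /gn.
apply: sigma_algebra_bigcup => k; rewrite /F.
case: choice.unpickle => [g|]; last exact: sigma_algebra0.
by case: asboolP => // _; exact: sigma_algebra0.
Qed.

Lemma measurable_agree Y a : finite_set Y -> measurable (agree Y a).
Proof.
move=> finY; have -> : agree Y a = \bigcap_(x in Y) [set n | n x = a x] by [].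
apply: fin_bigcap_measurable => // x _; apply: sub_sigma_algebra.
by exists x, (a x).
Qed.

Lemma measurable_cylinder_event A : cylinder_event A -> measurable A.
Proof.
move=> [Y finY AY].
have := determined_by_sigma (G := @measurable _ (config V)) finY AY.
rewrite sigma_algebra_id; last exact: sigma_algebra_measurable.
by apply=> a; exact: measurable_agree.
Qed.

Lemma measurable_fun_determined d (T : measurableType d) (f : config V -> T) Y :
  finite_set Y -> (forall n n', (forall x, Y x -> n x = n' x) -> f n = f n') ->
  measurable_fun setT f.
Proof.
move=> finY fY _ B _; rewrite setTI; apply: measurable_cylinder_event.
by exists Y => // n n' /fY; rewrite /preimage/= => ->.
Qed.

Lemma measurable_cylinder_sigma :
  @measurable _ (config V) = <<s @cylinder_event V >>.
Proof.
apply/seteqP; split => A.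
  apply: sub_sigma_algebra2 => _ [x [k [_ ->]]].
  by exists [set x]; [exact: finite_set1|move=> n n' /= <-].
have : <<s @cylinder_event V >> `<=` <<s @measurable _ (config V) >>.
  by apply: sub_sigma_algebra2 => B; exact: measurable_cylinder_event.
move=> /(_ A); by rewrite (sigma_algebra_id (@sigma_algebra_measurable _ (config V))).
Qed.

Lemma probability_cylinder_unique {R : realType} (P Q : probability (config V) R) :
  (forall A, cylinder_event A -> P A = Q A) ->
  forall A, measurable A -> P A = Q A.
Proof.
move=> PQ A mA.
have cT : cylinder_event [set: config V].
  by exists set0; [exact: finite_set0|].
apply: (measure_unique (@cylinder_event V) (fun=> setT)) => //.
- exact: measurable_cylinder_sigma.
- exact: cylinder_eventI.
- by rewrite bigcup_const//; exists 0%N.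
- by move=> n /=; rewrite probability_setT ltry.
Qed.

End cylinder_measurability.

(** * Invariance of a probability under a family of laws *)

Section stationary_kernel.
Context d (T : measurableType d) {R : realType}.
Variables (P : probability T R) (kappa : T -> probability T R).
Local Open Scope ereal_scope.

(** [kappa] is a mere family of probabilities: its measurability in the parameter is part of the
    property and is propagated along with it by the pi-lambda argument. *)
Let stationary : set (set T) := [set C | [/\ measurable C,
  measurable_fun setT (fun eta => kappa eta C) &
  P C = \int[P]_eta kappa eta C]].

Let stationary_dynkin : dynkin stationary.
Proof.
split.
- split; first exact: measurableT.
    apply: (eq_measurable_fun (cst 1)) => [eta _|]; last exact: measurable_cst.
    by rewrite /= probability_setT.
  under eq_integral do rewrite probability_setT.
  by rewrite integral_cst// mul1e.
- move=> C [mC mk PC].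
  have kC eta : kappa eta (~` C) = 1 - kappa eta C by rewrite probability_setC.
  have mkC : measurable_fun setT (fun eta => kappa eta (~` C)).
    apply: (eq_measurable_fun (fun eta => 1 - kappa eta C)).
      by move=> eta _; rewrite kC.
    by apply: emeasurable_funB => //; exact: measurable_cst.
  split => //; first exact: measurableC.
  have : \int[P]_eta (kappa eta C + kappa eta (~` C)) = 1.
    rewrite (eq_integral (cst 1)).
      by rewrite integral_cst//= probability_setT mule1.
    by move=> eta _; rewrite kC addeC subeK// fin_num_measure.
  rewrite ge0_integralD//.
  rewrite -PC probability_setC// => PC1.
  have PCfin : P C \is a fin_num by exact: fin_num_measure.
  by rewrite -PC1 addeAC subee// add0e.
- move=> F tF sF.
  have mF i : measurable (F i) by have [] := sF i.
  have kF eta : kappa eta (\bigcup_i F i) = \sum_(i <oo) kappa eta (F i).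
    by rewrite measure_bigcup//; apply: eq_eseriesl => i; rewrite in_setT.
  split; first exact: bigcupT_measurable.
    apply: (eq_measurable_fun (fun eta => \sum_(i <oo) kappa eta (F i))).
      by move=> eta _; rewrite kF.
    have := @ge0_emeasurable_sum _ T R setT (fun i eta => kappa eta (F i)) xpredT.
    apply=> // i _; by have [] := sF i.
  under eq_integral do rewrite kF.
  rewrite integral_nneseries//; last by move=> i; have [] := sF i.
  rewrite measure_bigcup//; rewrite (eq_eseriesl (Q := xpredT)); last first.
    by move=> i; rewrite in_setT.
  by apply: eq_eseriesr => i _; have [] := sF i.
Qed.

Lemma stationary_pi_lambda (G : set (set T)) :
  setI_closed G -> @measurable _ T = <<s G >> ->
  (forall C, G C -> measurable_fun setT (fun eta => kappa eta C) /\
    P C = \int[P]_eta kappa eta C) ->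
  forall C, measurable C -> P C = \int[P]_eta kappa eta C.
Proof.
move=> IG mG GP C; rewrite mG => GC.
suff : stationary C by case.
have := @lambda_system_subset _ G IG setT stationary
  ((dynkin_lambda_system _).1 stationary_dynkin).
apply=> //; move=> D GD; have [mk PD] := GP _ GD; split => //.
by rewrite mG; exact: sub_sigma_algebra.
Qed.

End stationary_kernel.

(** * Linear growth of convex even interactions *)

Section superlinear_growth.
Context {R : realType}.

(** By evenness and convexity [U 0] is the minimum, and nonconstancy gives [p > 0] with [U 0 < U p].
    Beyond [p], convexity keeps [U] above the line of slope [c] through its values at 0 and [p]; the
    constant [c * p - U 0] makes the bound at most [U 0] for [0 <= q <= p]. *)
Lemma convex_even_growth (U : int -> R) : convex_interaction U ->
  nonconstant U -> (forall q, U (- q) = U q) ->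
  exists2 c : R, 0 < c & exists C, forall q : int, c * `|q%:~R| - C <= U q.
Proof.
move=> cU [q1 [q2 U12]] evenU.
have U0 q : U 0 <= U q.
  wlog q0 : q / 0 <= q => [H|].
    have [/H//|/ltW q0] := leP 0 q.
    by rewrite -(evenU q); apply: H; rewrite oppr_ge0.
  move: q0; rewrite le_eqVlt => /predU1P[<-//|q0].
  have := cU (- q) 0 q; rewrite oppr_le0 (ltW q0) evenU => /(_ isT isT).
  rewrite subr0 sub0r !opprK intrD.
  have : 0 < q%:~R :> R by rewrite ltr0z.
  move: (q%:~R) (U 0) (U q) => r a b; nra.
have [p p0 Up] : exists2 p, 0 < p & U 0 < U p.
  have [q qU] : exists q, U q != U 0.
    apply: contrapT => H; apply: U12.
    have Uq q : U q = U 0 by apply/eqP/negPn/negP => Hq; apply: H; exists q.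
    by rewrite !Uq.
  have qlt : U 0 < U q by rewrite lt_neqAle eq_sym qU U0.
  have [q0|q0|q0] := ltgtP 0 q; first by exists q.
    by exists (- q); rewrite ?oppr_gt0// evenU.
  by rewrite -q0 ltxx in qlt.
have pR : 0 < p%:~R :> R by rewrite ltr0z.
pose c := (U p - U 0) / p%:~R.
have c0 : 0 < c by rewrite divr_gt0// subr_gt0.
exists c => //; exists (c * p%:~R - U 0).
suff pos q : 0 <= q -> c * q%:~R - (c * p%:~R - U 0) <= U q.
  move=> q; have [q0|q0] := leP 0 q.
    by rewrite ger0_norm ?ler0z//; exact: pos.
  rewrite ltr0_norm ?ltrz0// -(evenU q) -mulrNz; apply: pos.
  by rewrite oppr_ge0 ltW.
move=> q0; have [qp|pq] := leP q p.
  have : q%:~R <= p%:~R :> R by rewrite ler_int.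
  by have := U0 q; nra.
have := cU 0 p q (ltW p0) (ltW pq).
have pqR : p%:~R < q%:~R :> R by rewrite ltr_int.
rewrite subr0 intrB => H.
have -> : c * q%:~R - (c * p%:~R - U 0) = c * (q%:~R - p%:~R) + U 0 by ring.
have E : c * p%:~R = U p - U 0 by rewrite /c divfK// gt_eqF.
rewrite -(ler_pM2l pR); move: c E c0 => c E c0; nra.
Qed.

End superlinear_growth.

(** * Summability of geometric weights *)

Section geometric_mass.
Context {R : realType} {V : choiceType}.

Lemma sum_geometric_dist_le (r : R) J : 0 <= r -> r < 1 ->
  \sum_(j < J + J.+1) r ^+ `|j%:Z - J%:Z|%N <= 2 / (1 - r).
Proof.
move=> r0 r1; rewrite big_split_ord/= mulrDl mul1r; apply: lerD.
  apply: le_trans (sum_geometric_le J r0 r1); rewrite (reindex_inj rev_ord_inj)/=.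
  apply: ler_sum => i _; apply: ler_wiXn2l; rewrite ?r0 ?ltW//.
  by have := ltn_ord i; lia.
apply: le_trans (sum_geometric_le J.+1 r0 r1); apply: ler_sum => i _.
by rewrite (_ : `|_|%N = i)//; lia.
Qed.

(** On the box of heights from [-J] to [J] the sum of the product factorizes into one-site sums,
    each at most [2 / (1 - r)] whatever [J] is. *)
Lemma mass_geometric (K : set V) (r : R) : finite_set K -> 0 <= r -> r < 1 ->
  (mass K (fun n => (\prod_(i : fset_set K) r ^+ `|n (val i)|%N)%R) < +oo)%E.
Proof.
move=> finK r0 r1; pose k := #|{: fset_set K}|.
apply: (@le_lt_trans _ _ (((2 / (1 - r)) ^+ k)%:E)); last exact: ltry.
apply: ge_ereal_sup => _ [X [finX XK] <-].
pose J := (\sum_(n <- fset_set X) \sum_(i : fset_set K) `|n (val i)|)%N.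
have XJ n (i : fset_set K) : X n -> (`|n (val i)| <= J)%N.
  move=> Xn; rewrite /J (big_fsetD1 n)/=; last by rewrite in_fset_set ?inE.
  by rewrite (bigD1 i)//= -addnA leq_addr.
pose box (g : {ffun fset_set K -> 'I_(J + J.+1)}) : config V :=
  conf_of_ffun [ffun i => (g i)%:Z - J%:Z].
have box_inj : injective box.
  move=> g g' /conf_of_ffun_inj /ffunP gg'; apply/ffunP => i; apply/val_inj.
  by have := gg' i; rewrite !ffunE /=; lia.
have f0 (n : config V) : 0 <= \prod_(i : fset_set K) r ^+ `|n (val i)|%N.
  by apply: prodr_ge0 => i _; exact: exprn_ge0.
apply: (@le_trans _ _ (\esum_(n in range box)
    (\prod_(i : fset_set K) r ^+ `|n (val i)|%N)%:E)%E).
  apply: ereal_sup_ubound; exists X => //; split => // n Xn.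
  have lt (i : fset_set K) : (`|(n (val i) + J%:Z)%R| < J + J.+1)%N.
    by have := XJ _ i Xn; move: (n _) => z; lia.
  exists [ffun i => Ordinal (lt i)] => //; apply: (supported_in_eqP finK).
  - exact: conf_of_ffun_supported.
  - exact: XK.
  - move=> i; rewrite /box conf_of_ffunE !ffunE/=.
    by have := XJ _ i Xn; move: (n _) => z; lia.
rewrite esum_range// lee_fin.
under eq_bigr do under eq_bigr do rewrite /box conf_of_ffunE ffunE.
rewrite -(bigA_distr_bigA (fun (i : fset_set K) (j : 'I_(J + J.+1)) =>
  r ^+ `|j%:Z - J%:Z|%N))/=.
rewrite prodr_const; apply: lerXn2r; rewrite ?nnegrE.
- by apply: sumr_ge0 => j _; exact: exprn_ge0.
- by rewrite divr_ge0 ?subr_ge0 ?ltW.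
- exact: sum_geometric_dist_le.
Qed.

End geometric_mass.

(** * Boltzmann weights of finite volumes *)

Section gibbs_weights.
Context {R : realType} {V : choiceType} (adj : rel V) (U : int -> R).
Hypothesis adj_sym : symmetric adj.
Hypothesis adj_irr : irreflexive adj.
Hypothesis adj_fin : forall x, finite_set [set y | adj x y].
Hypothesis U_even : forall q, U (- q) = U q.
Implicit Types (K S Y : set V) (n m : config V) (E : set (V * V)).

Let h q := expR (- U q).

(** [K] is the set of free vertices: with the heights fixed outside of [K], the edges not meeting
    [K] would contribute a constant factor. *)
Definition weight K n := expR (- energy U (edges_meeting adj K) n).

Lemma weight_gt0 K n : 0 < weight K n. Proof. exact: expR_gt0. Qed.
Lemma weight_ge0 K n : 0 <= weight K n. Proof. exact: expR_ge0. Qed.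

Lemma edges_meeting_finite K : finite_set K ->
  finite_set (edges_meeting adj K).
Proof.
move=> finK.
pose N := K `|` \bigcup_(x in K) [set y | adj x y].
have finN : finite_set N.
  by rewrite finite_setU; split => //; apply: bigcup_finite.
apply: (sub_finite_set _ (finite_setX finN finN)) => -[x y] [/= xy [Kx|Ky]].
  by split; [left|right; exists x].
by split; [right; exists y; rewrite //= adj_sym|left].
Qed.

Lemma energy_setD E E' n : finite_set E' -> E `<=` E' ->
  energy U E' n = energy U E n + energy U (E' `\` E) n :> R.
Proof.
move=> finE' EE'; rewrite /energy -mulrDr; congr (_ * _).
by rewrite (fsbigID E)//= setIidr.
Qed.

Lemma eq_energy E n m : (forall e, E e -> n e.1 - n e.2 = m e.1 - m e.2) ->
  energy U E n = energy U E m :> R.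
Proof.
by move=> nm; rewrite /energy; congr (_ * _); apply: eq_fsbigr => e;
  rewrite inE => /nm ->.
Qed.

(** An edge of [E] that does not meet [K] joins two vertices of height zero, so the extra edges
    contribute a factor independent of [n]. This compares a volume both with a larger one and with
    an induced subgraph. *)
Lemma expR_energy_supported K E : finite_set E ->
  edges_meeting adj K `<=` E -> (forall e, E e -> adj e.1 e.2) ->
  exists2 c : R, 0 < c & forall n, supported_in K n ->
    expR (- energy U E n) = c * weight K n.
Proof.
move=> finE KE Eadj.
exists (expR (- energy U (E `\` edges_meeting adj K) (@conf0 V))).
  exact: expR_gt0.
move=> n Kn; rewrite (energy_setD n finE KE) opprD expRD mulrC; congr (_ * _).
congr (expR (- _)); apply: eq_energy => e [Ee nKe].
by rewrite !Kn// => Ke; apply: nKe; split; [exact: Eadj|right|exact: Eadj|left].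
Qed.

(** Each edge is listed in both orientations with the factor 1/2; as [U] is even, one orientation
    may be kept with the factor 1. The product form lets kernels be multiplied edge by edge and a
    single edge be removed. *)
Lemma weight_prod K : finite_set K -> exists el : seq (V * V),
  [/\ uniq el,
      forall n, weight K n = \prod_(e <- el) h (n e.1 - n e.2) &
      forall x y, adj x y -> K x \/ K y -> (x, y) \in el \/ (y, x) \in el].
Proof.
move=> finK; set E := edges_meeting adj K.
have finE : finite_set E := edges_meeting_finite finK.
pose sE : seq (V * V) := fset_set E.
have sEP e : (e \in sE) = `[< E e >] by rewrite in_fset_set.
pose s := [seq e.1 | e <- sE].
(* An edge is oriented by the positions of its ends in the list [s], in place of an order on [V];
   the positions differ because there are no loops. *)
pose o (e : V * V) := (index e.1 s < index e.2 s)%N.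
pose sw (e : V * V) := (e.2, e.1).
have swE e : E e -> E (sw e).
  by move=> [a b]; split; rewrite /= 1?adj_sym//; case: b; [right|left].
have os e : E e -> o (sw e) = ~~ o e.
  move=> Ee; rewrite /o /= -leqNgt [RHS]leq_eqVlt eq_sym.
  suff /negbTE -> : index e.1 s != index e.2 s by [].
  apply/negP => /eqP /index_inj H.
  have e1 : e.1 \in s by apply: map_f; rewrite sEP asboolE.
  have e2 : e.2 \in s.
    by apply/mapP; exists (sw e) => //; rewrite sEP asboolE; exact: swE.
  by case: Ee => + _; rewrite (H e.1 e1 e2) adj_irr.
have uE : uniq sE by exact: fset_uniq.
exists [seq e <- sE | o e]; split.
- exact: filter_uniq.
- move=> n; rewrite /weight /energy.
  rewrite fsbig_finite// -/sE -(expR_sum _ _ (fun e => - U (n e.1 - n e.2))).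
  congr expR; rewrite sumrN; congr (- _).
  rewrite (bigID o)/= -[X in _ * (_ + X)]big_filter.
  have -> : \sum_(e <- [seq e <- sE | ~~ o e]) U (n e.1 - n e.2) =
            \sum_(e <- [seq e <- sE | o e]) U (n e.1 - n e.2).
    transitivity (\sum_(e <- [seq sw e | e <- [seq e <- sE | o e]])
        U (n e.1 - n e.2)).
      apply: perm_big; apply: uniq_perm.
      + exact: filter_uniq.
      + by rewrite map_inj_uniq ?filter_uniq// => -[a b] [c d] [-> ->].
      move=> e; rewrite mem_filter sEP; apply/andP/mapP.
        move=> [oe /asboolP Ee]; exists (sw e); last by case: (e).
        by rewrite mem_filter sEP os// oe; apply/asboolP/swE.
      move=> [e']; rewrite mem_filter sEP => /andP[oe' /asboolP Ee'] ->.
      by rewrite os// oe'; split=> //; apply/asboolP/swE.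
    rewrite big_map; apply: eq_bigr => e _ /=.
    by rewrite -U_even opprB.
  by rewrite big_filter; lra.
- move=> x y xy Kxy.
  have Exy : E (x, y) by split.
  rewrite !mem_filter !sEP (asboolT Exy) (asboolT (swE _ Exy)) !andbT.
  by have := os _ Exy; rewrite /sw/= => ->; case: (o _); [left|right].
Qed.

Definition glue K n eta : config V := fun x => if x \in K then n x else eta x.

Definition outside_agree K eta : set (config V) :=
  [set n | forall x, ~ K x -> n x = eta x].

Lemma glue_bij K eta :
  set_bij (supported_in K) (outside_agree K eta) (glue K ^~ eta).
Proof.
split.
- by move=> n _ x Kx; rewrite /glue memNset.
- move=> n m; rewrite !inE => Kn Km /funeqP nm; apply/funext => x.
  have [Kx|Kx] := pselect (K x); last by rewrite Kn// Km.
  by have := nm x; rewrite /glue mem_set.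
- move=> n Kn; exists (glue K n (@conf0 V)).
    by move=> x Kx; rewrite /glue memNset.
  apply/funext => x; rewrite /glue; have [Kx|Kx] := pselect (K x).
    by rewrite mem_set.
  by rewrite memNset// Kn.
Qed.

(** * Finiteness of the partition functions *)

Variables (c C : R).
Hypothesis c_gt0 : 0 < c.
Hypothesis U_growth : forall q : int, c * `|q%:~R| - C <= U q.
Hypothesis adj_conn : connected_graph adj.
Hypothesis V_infinite : ~ finite_set [set: V].

Let total_gradient K n : R :=
  \sum_(e <- fset_set (edges_meeting adj K)) `|(n e.1 - n e.2)%:~R|.

Let total_gradient_ge K n x y : finite_set K -> adj x y -> K x ->
  `|(n x - n y)%:~R| <= total_gradient K n.
Proof.
move=> finK xy Kx; rewrite /total_gradient (big_fsetD1 (x, y))/=.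
  by rewrite lerDl; apply: sumr_ge0.
rewrite in_fset_set; last exact: edges_meeting_finite.
by rewrite inE; split => //; left.
Qed.

(** Telescope along the path up to its first vertex outside of [K], where the height is prescribed;
    each step before it costs at most the total gradient. *)
Let height_le K eta n x p : finite_set K -> outside_agree K eta n ->
  path adj x p -> ~ K (last x p) ->
  `|(n x)%:~R| <=
    total_gradient K n *+ size p + \sum_(z <- x :: p) `|(eta z)%:~R|.
Proof.
move=> finK nK; elim: p x => [|y p IH] x /=.
  by move=> _ Kx; rewrite nK// big_seq1 mulr0n add0r.
move=> /andP[xy yp] Kl; have T0 : 0 <= total_gradient K n by exact: sumr_ge0.
rewrite big_cons; have [Kx|Kx] := pselect (K x); last first.
  by rewrite nK// addrCA lerDl addr_ge0 ?mulrn_wge0 ?sumr_ge0.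
rewrite -(subrK (n y) (n x)) intrD; apply: le_trans (ler_normD _ _) _.
have := total_gradient_ge n finK xy Kx; have := IH _ yp Kl.
have : 0 <= `|(eta x)%:~R : R| by [].
by rewrite mulrS; lra.
Qed.

(** An infinite vertex set leaves a vertex outside of [K], to which paths lead from all of [K].
    Hence large heights force a large total gradient, and the growth of [U] makes the energy at
    least linear in it. *)
Lemma weight_le_geometric K eta : finite_set K ->
  exists A r : R, [/\ 0 <= A, 0 <= r, r < 1 & forall n, outside_agree K eta n ->
    weight K n <= A * \prod_(i : fset_set K) r ^+ `|n (val i)|%N].
Proof.
move=> finK; have [z0 Kz0] : exists z, ~ K z.
  apply: contrapT => H; apply: V_infinite; apply: sub_finite_set finK => z _.
  by apply: contrapT => Kz; apply: H; exists z.
have /choice[p pP] : forall x, exists p : seq V, path adj x p /\ ~ K (last x p).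
  by move=> x; have [p xp xz0] := adj_conn x z0; exists p; rewrite xz0.
pose M := (\sum_(i : fset_set K) size (p (val i)))%N.
pose B : R := \sum_(i : fset_set K)
  \sum_(z <- val i :: p (val i)) `|(eta z)%:~R|.
(* Summed over [K], the heights are at most [M.+1] times the total gradient plus [B], and the energy
   is at least [c / 2] times the total gradient minus a constant; [M.+1] instead of [M] avoids
   dividing by zero. *)
pose d := c / 2 / M.+1%:R.
have d0 : 0 < d by rewrite divr_gt0// divr_gt0.
pose nE : R := (size (fset_set (edges_meeting adj K)))%:R.
exists (expR (2^-1 * (C * nE) + d * B)), (expR (- d)); split.
- exact: expR_ge0.
- exact: expR_ge0.
- by rewrite expR_lt1 oppr_lt0.
move=> n nK; have finE := edges_meeting_finite finK.
under eq_bigr do rewrite -expRM_natl.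
rewrite -expR_sum -expRD ler_expR.
have -> : \sum_(i : fset_set K) `|n (val i)|%N%:R * - d =
          - (d * \sum_(i : fset_set K) `|(n (val i))%:~R|).
  rewrite mulr_sumr -sumrN; apply: eq_bigr => i _.
  by rewrite mulrN mulrC natr_absz intr_norm.
have sumle : \sum_(i : fset_set K) `|(n (val i))%:~R| <=
    total_gradient K n * M.+1%:R + B.
  apply: (@le_trans _ _ (total_gradient K n *+ M + B)).
    rewrite /M -sumrMnr -big_split/=; apply: ler_sum => i _.
    by have [ip Kl] := pP (val i); exact: height_le.
  by rewrite lerD2r mulr_natr mulrS lerDr sumr_ge0.
have energyge : 2^-1 * (c * total_gradient K n - C * nE) <=
    energy U (edges_meeting adj K) n.
  rewrite /energy ler_pM2l// fsbig_finite//= /total_gradient mulr_sumr.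
  rewrite /nE -sum1_size natr_sum mulr_sumr -sumrB; apply: ler_sum => e _.
  by rewrite mulr1; exact: U_growth.
have dM : d * M.+1%:R = c / 2 by rewrite /d divfK.
have := ler_wpM2l (ltW d0) sumle; rewrite mulrDr mulrCA dM.
move: energyge; move: (energy _ _ _) (total_gradient K n) => e T.
move: (\sum_i _) => S'; move: (d * S') (d * B) nE => x y z; lra.
Qed.

Lemma weight_mass_fin K eta : finite_set K ->
  (\esum_(n in outside_agree K eta) (weight K n)%:E < +oo)%E.
Proof.
move=> finK; have [A [r [A0 r0 r1 Wle]]] := weight_le_geometric eta finK.
rewrite (reindex_esum _ _ _ _ (glue_bij K eta)).
apply: (@le_lt_trans _ _ (A%:E * mass K (fun n =>
    (\prod_(i : fset_set K) r ^+ `|n (val i)|%N)%R))%E).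
  rewrite /mass -esumZl//; last first.
    by move=> n _; rewrite lee_fin prodr_ge0// => i _; exact: exprn_ge0.
  apply: le_esum => n Kn; rewrite -EFinM lee_fin.
  apply: le_trans (Wle _ _) _; first by case: (glue_bij K eta) => + _ _; apply.
  rewrite le_eqVlt; apply/orP; left; apply/eqP; congr (_ * _).
  apply: eq_bigr => i _; rewrite /glue mem_set//.
  by have := valP i; rewrite in_fset_set// inE.
have := mass_geometric finK r0 r1.
have : (0 <= mass K (fun n => (\prod_(i : fset_set K) r ^+ `|n (val i)|%N)%R))%E.
  by apply: mass_ge0 => n; apply: prodr_ge0 => i _; exact: exprn_ge0.
by case: mass => // x _ _; rewrite -EFinM ltry.
Qed.

Lemma weight_mass_gt0 K eta :
  (0 < \esum_(n in outside_agree K eta) (weight K n)%:E)%E.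
Proof.
apply: (@lt_le_trans _ _ (weight K eta)%:E); first by rewrite lte_fin weight_gt0.
rewrite -(@esum_set1 _ _ eta (fun n => (weight K n)%:E)) ?lee_fin ?weight_ge0//.
by apply: esum_subset => _ ->.
Qed.

(** * Finite-volume expectations *)

Definition bounded_nonneg (F : config V -> R) :=
  (forall n, 0 <= F n) /\ exists M, forall n, F n <= M.

(** [fine] loses nothing for finite [K] and [bounded_nonneg] functions: both masses are finite and
    the denominator is positive. *)
Definition expect K (F : config V -> R) : R :=
  fine (mass K (fun n => weight K n * F n)) / fine (mass K (weight K)).

Let Wmass_fin K : finite_set K -> mass K (weight K) \is a fin_num.
Proof.
move=> finK; rewrite ge0_fin_numE; last by apply: mass_ge0 => n; exact: expR_ge0.
exact: weight_mass_fin (@conf0 V) finK.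
Qed.

Let Wmass_gt0 K : finite_set K -> 0 < fine (mass K (weight K)).
Proof.
move=> finK; rewrite -lte_fin fineK ?Wmass_fin//.
exact: weight_mass_gt0 K (@conf0 V).
Qed.

Lemma mass_bounded_fin K F : finite_set K -> bounded_nonneg F ->
  mass K (fun n => weight K n * F n) \is a fin_num.
Proof.
move=> finK [F0 [M FM]]; have M0 : 0 <= M by exact: le_trans (FM (@conf0 V)).
rewrite ge0_fin_numE; last by apply: mass_ge0 => n; rewrite mulr_ge0 ?expR_ge0.
apply: (@le_lt_trans _ _ (M%:E * mass K (weight K))%E).
  rewrite -esumZl//; last by move=> n _; rewrite lee_fin expR_ge0.
  apply: le_esum => n _; rewrite -EFinM lee_fin mulrC.
  by rewrite ler_wpM2r ?expR_ge0.
by rewrite -(fineK (Wmass_fin finK)) -EFinM ltry.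
Qed.

Lemma expect_ge0 K F : (forall n, 0 <= F n) -> 0 <= expect K F.
Proof.
move=> F0; rewrite divr_ge0// fine_ge0// mass_ge0// => n; last exact: expR_ge0.
by rewrite mulr_ge0 ?expR_ge0.
Qed.

Lemma le_expect K F H : finite_set K -> bounded_nonneg F -> bounded_nonneg H ->
  (forall n, supported_in K n -> F n <= H n) -> expect K F <= expect K H.
Proof.
move=> finK bF bH FH; rewrite ler_pM2r ?invr_gt0 ?Wmass_gt0//.
rewrite -lee_fin !fineK ?mass_bounded_fin//; apply: le_esum => n /FH Fn.
by rewrite lee_fin ler_wpM2l ?expR_ge0.
Qed.

Lemma eq_expect K F H : (forall n, supported_in K n -> F n = H n) ->
  expect K F = expect K H.
Proof.
move=> FH; congr (fine _ / _); apply: eq_esum => n /FH Fn.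
by rewrite Fn.
Qed.

Lemma expect1 K : finite_set K -> expect K (fun=> 1) = 1.
Proof.
move=> finK; rewrite /expect (_ : (fun n => _) = weight K).
  by rewrite divff// gt_eqF ?Wmass_gt0.
by apply/funext => n; rewrite mulr1.
Qed.

Lemma expectD K F H : finite_set K -> bounded_nonneg F -> bounded_nonneg H ->
  expect K (fun n => F n + H n) = expect K F + expect K H.
Proof.
move=> finK bF bH; rewrite /expect -mulrDl; congr (_ / _).
rewrite -fineD ?mass_bounded_fin// /mass -esumD.
- by congr fine; apply: eq_esum => n _; rewrite mulrDr EFinD.
- by move=> n _; rewrite lee_fin mulr_ge0 ?expR_ge0//; exact: bF.1.
- by move=> n _; rewrite lee_fin mulr_ge0 ?expR_ge0//; exact: bH.1.
Qed.

Lemma bounded_nonneg_indic (A : set (config V)) : bounded_nonneg \1_A.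
Proof. by split=> [n|]; [|exists 1 => n]; rewrite indicE; case: (_ \in _). Qed.

Lemma bounded_nonnegD F H : bounded_nonneg F -> bounded_nonneg H ->
  bounded_nonneg (fun n => F n + H n).
Proof.
move=> [F0 [M FM]] [H0 [N HN]]; split=> [n|]; first exact: addr_ge0.
by exists (M + N) => n; exact: lerD.
Qed.

Lemma bounded_nonnegZ a F : 0 <= a -> bounded_nonneg F ->
  bounded_nonneg (fun n => a * F n).
Proof.
move=> a0 [F0 [M FM]]; split=> [n|]; first exact: mulr_ge0.
by exists (a * M) => n; exact: ler_wpM2l.
Qed.

Lemma bounded_nonneg_cst a : 0 <= a -> bounded_nonneg (fun=> a).
Proof. by move=> a0; split=> //; exists a. Qed.

Lemma expectZ K a F : finite_set K -> 0 <= a -> bounded_nonneg F ->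
  expect K (fun n => a * F n) = a * expect K F.
Proof.
move=> finK a0 bF; rewrite /expect mulrA; congr (_ / _).
apply: EFin_inj; rewrite EFinM !fineK ?mass_bounded_fin//; last first.
  exact: bounded_nonnegZ.
rewrite /mass -esumZl//.
  by apply: eq_esum => n _; rewrite mulrCA EFinM.
by move=> n _; rewrite lee_fin mulr_ge0 ?expR_ge0//; exact: bF.1.
Qed.

(** * Monotonicity in the volume *)

Hypothesis h_pd : posker (fun x y : int => h (x - y)).
Hypothesis h_pair : forall p,
  posker (fun u v : int => h (p + u + v) * h (u - v)).

Lemma weight_pair_positive K : finite_set K -> pair_positive (weight K).
Proof.
move=> finK p; have [el [_ WE _]] := weight_prod finK.
have := @posker_prod R (config V) _ el (fun e u v =>
  h (confD (confD p u) v e.1 - confD (confD p u) v e.2) *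
  h (confB u v e.1 - confB u v e.2)).
have pk e : posker (fun u v : config V =>
    h (confD (confD p u) v e.1 - confD (confD p u) v e.2) *
    h (confB u v e.1 - confB u v e.2)).
  have := posker_comp (fun u : config V => u e.1 - u e.2)
    (h_pair (p e.1 - p e.2)).
  apply: posker_ext => u v; congr (h _ * h _); rewrite /confD /confB; lia.
move=> /(_ (fun e _ => pk e)); apply: posker_ext => u v.
by rewrite !WE big_split.
Qed.

(** On [supported_in K], [weight K'] is a constant multiple of [weight K]; the constant cancels in
    Ginibre's inequality, which becomes the comparison of the two expectations. *)
Lemma expect_antitone K K' F : finite_set K -> finite_set K' -> K `<=` K' ->
  bounded_nonneg F -> difference_positive F -> expect K' F <= expect K F.
Proof.
move=> finK finK' KK' bF pF.
pose H : config V -> R := \1_(supported_in K).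
have bH : bounded_nonneg H by exact: bounded_nonneg_indic.
have pH : difference_positive H.
  apply: even_positive_definite.
    move=> u; rewrite /H !indicE; congr (_ %:R); congr nat_of_bool.
    apply/idP/idP; rewrite !inE => Hu x /Hu; rewrite /confN.
      by move=> /eqP; rewrite oppr_eq0 => /eqP.
    by move=> ->; rewrite oppr0.
  (* [H (confB u v)] tests whether [u] and [v] agree after erasing their values on [K], so it is an
     equality kernel. *)
  have := posker_comp (fun u : config V => (fun x => if x \in K then 0 else u x)
    : config V) (@posker_eq R (config V)).
  apply: posker_ext => u v; rewrite /H indicE; congr (_ %:R); congr nat_of_bool.
  apply/eqP/idP; rewrite inE.
    move=> /funeqP uv x Kx; have := uv x; rewrite memNset// => uvx.
    by rewrite /confB uvx subrr.
  move=> uv; apply/funext => x; case: ifPn => //; rewrite notin_setE => Kx.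
  by have := uv x Kx; rewrite /confB => /eqP; rewrite subr_eq0 => /eqP.
have KE : edges_meeting adj K `<=` edges_meeting adj K'.
  by move=> e [ea [/KK' ?|/KK' ?]]; split => //; [left|right].
have [c' c'0 c'E] := expR_energy_supported (edges_meeting_finite finK') KE
  (fun e Ee => Ee.1).
have restrict f : (forall n, 0 <= f n) ->
    mass K' (fun n => weight K' n * (f n * H n)) =
    (c'%:E * mass K (fun n => weight K n * f n)%R)%E.
  move=> f0; rewrite /mass -esumZl; last 2 first.
  - exact: ltW.
  - by move=> n _; rewrite lee_fin mulr_ge0// expR_ge0.
  have -> : supported_in K = supported_in K' `&` supported_in K :> set (config V).
    by rewrite setIidr// => n Kn x K'x; apply: Kn => /KK'.
  rewrite esum_mkcondr; apply: eq_esum => n _; rewrite /H indicE.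
  case: ifPn => [|_]; last by rewrite !mulr0.
  by rewrite inE mulr1 => Kn; rewrite [weight K' n]c'E// -mulrA EFinM.
have H01 n : H n = 1 * H n by rewrite mul1r.
have pos n : 0 <= weight K' n * H n by rewrite mulr_ge0 ?expR_ge0 ?bH.1.
have bFH : bounded_nonneg (fun n => F n * H n).
  case: bF => F0 [M FM]; split=> [n|]; first by rewrite mulr_ge0 ?bH.1.
  exists M => n; rewrite /H indicE; case: (_ \in _); rewrite ?mulr1// mulr0.
  exact: le_trans (FM (@conf0 V)).
have fin f : bounded_nonneg f ->
    (mass K' (fun n => weight K' n * f n)%R < +oo)%E.
  by move=> bf; rewrite ltey_eq mass_bounded_fin.
have := @mass_correlation R V K' (weight K') F H (weight_ge0 K') bF.1 bH.1
  (weight_pair_positive finK') pF pH (weight_mass_fin (@conf0 V) finK')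
  (fin _ bF) (fin _ bH) (fin _ bFH).
rewrite (restrict _ bF.1).
have -> : mass K' (fun n => weight K' n * H n) = (c'%:E * mass K (weight K))%E.
  have := restrict (fun=> 1) (fun=> ler01).
  under [X in mass K' X]eq_fun do rewrite mul1r.
  by move=> ->; congr (_ * mass K _)%E; apply/funext => n; rewrite mulr1.
rewrite -(fineK (mass_bounded_fin finK' bF)) -(fineK (mass_bounded_fin finK bF)).
rewrite -(fineK (Wmass_fin finK)) -(fineK (Wmass_fin finK')) -!EFinM lee_fin.
rewrite mulrCA [leRHS]mulrCA ler_pM2l// => le.
rewrite /expect ler_pdivrMr ?Wmass_gt0// mulrAC ler_pdivlMr ?Wmass_gt0//.
by rewrite [leRHS]mulrC.
Qed.

(** * Convergence of the probabilities of finite patterns *)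

Lemma agreeN Y a n : agree Y (confN a) (confN n) <-> agree Y a n.
Proof.
split=> H x /H; rewrite /confN; first by move=> /oppr_inj.
by move=> ->.
Qed.

Lemma expect_confN K F : expect K (fun n => F (confN n)) = expect K F.
Proof.
rewrite /expect; congr (fine _ / _); rewrite /mass.
rewrite [RHS](reindex_esum (supported_in K) (supported_in K) (@confN V)).
  apply: eq_esum => n _; congr (_ * _)%:E; rewrite /weight; congr (expR (- _)).
  rewrite /energy; congr (_ * _); apply: eq_fsbigr => e _.
  by rewrite -U_even /confN opprB opprK addrC.
split.
- by move=> n Kn x Kx; rewrite /confN Kn// oppr0.
- by move=> n m _ _ /funeqP nm; apply/funext => x; have /oppr_inj := nm x.
- move=> n Kn; exists (confN n).
    by move=> x Kx; rewrite /confN Kn// oppr0.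
  by apply/funext => x; rewrite /confN opprK.
Qed.

Let restr Y (u : config V) : config V := fun x => if x \in Y then u x else 0.

Let restr_eq Y u v : restr Y u = restr Y v <-> agree Y v u.
Proof.
split=> [/funeqP uv x Yx|uv].
  by have := uv x; rewrite /restr mem_set.
apply/funext => x; rewrite /restr; case: ifPn => //.
by rewrite inE => /uv.
Qed.

Lemma agree0_positive_definite Y :
  positive_definite (\1_(agree Y (@conf0 V)) : config V -> R).
Proof.
have := posker_comp (restr Y) (@posker_eq R (config V)).
apply: posker_ext => u v; rewrite indicE; congr (_ %:R); congr nat_of_bool.
apply/eqP/idP; rewrite inE.
  by move=> /restr_eq uv x /uv; rewrite /confB => ->; rewrite subrr.
move=> uv; apply/restr_eq => x /uv /eqP.
by rewrite /confB subr_eq0 => /eqP.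
Qed.

Let agree0_difference_positive Y :
  difference_positive (\1_(agree Y (@conf0 V)) : config V -> R).
Proof.
apply: even_positive_definite (agree0_positive_definite Y) => u.
rewrite !indicE; congr (_ %:R); congr nat_of_bool.
have c0 : confN (@conf0 V) = @conf0 V by apply/funext => x; exact: oppr0.
by apply/idP/idP; rewrite !inE => Hu; [apply/agreeN|rewrite -c0; apply/agreeN];
  rewrite ?c0.
Qed.

(* 1 + cos = |1 + exp|^2 / 2: the weights 1, 2, 1 make this function
   positive definite, which the indicator function of one value is not. *)
Let triple Y a : config V -> R := fun n =>
  2 * \1_(agree Y (@conf0 V)) n + (\1_(agree Y a) n + \1_(agree Y (confN a)) n).

Let bounded_triple Y a : bounded_nonneg (triple Y a).
Proof.
apply: bounded_nonnegD; first exact/bounded_nonnegZ/bounded_nonneg_indic.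
by apply: bounded_nonnegD; exact: bounded_nonneg_indic.
Qed.

Let triple_difference_positive Y a : difference_positive (triple Y a).
Proof.
apply: even_positive_definite.
  move=> u; rewrite /triple; congr (2 * _ + _).
    rewrite !indicE; congr (_ %:R); congr nat_of_bool.
    have c0 : confN (@conf0 V) = @conf0 V by apply/funext => x; exact: oppr0.
    by apply/idP/idP; rewrite !inE => Hu;
      [apply/agreeN|rewrite -c0; apply/agreeN]; rewrite ?c0.
  rewrite addrC !indicE; congr (_ %:R + _ %:R); congr nat_of_bool.
    apply/idP/idP; rewrite !inE => Hu; first exact/agreeN.
    exact/(agreeN Y a u).
  have aK : confN (confN a) = a by apply/funext => x; exact: opprK.
  apply/idP/idP; rewrite !inE => Hu; last by rewrite -aK; apply/agreeN.
  by apply/agreeN; rewrite aK.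
have := posker_double (fun=> 1 : R) (fun (b : bool) u => if b then confD u a else u)
  (posker_comp (restr Y) (@posker_eq R (config V))).
apply: posker_ext => u v; rewrite !big_bool/= !mulr1 !mul1r /triple !indicE.
have -> : (restr Y (confD u a) == restr Y (confD v a)) = (restr Y u == restr Y v).
  apply/eqP/eqP => /restr_eq uv; apply/restr_eq => x /uv; rewrite /confD.
    by move=> /addIr.
  by move=> ->.
have -> : (confB u v \in agree Y (@conf0 V)) = (restr Y u == restr Y v).
  apply/idP/eqP; rewrite inE; [move=> H|move=> /restr_eq H].
    by apply/restr_eq => x /H /eqP; rewrite /confB subr_eq0 => /eqP.
  by move=> x /H; rewrite /confB => ->; rewrite subrr.
have -> : (confB u v \in agree Y a) = (restr Y u == restr Y (confD v a)).
  apply/idP/eqP; rewrite inE; [move=> H|move=> /restr_eq H].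
    by apply/restr_eq => x /H; rewrite /confB /confD; lia.
  by move=> x /H; rewrite /confB /confD; lia.
have -> : (confB u v \in agree Y (confN a)) = (restr Y (confD u a) == restr Y v).
  apply/idP/eqP; rewrite inE; [move=> H|move=> /restr_eq H].
    by apply/restr_eq => x /H; rewrite /confB /confD /confN; lia.
  by move=> x /H; rewrite /confB /confD /confN; lia.
by ring.
Qed.

(** By the flip symmetry the patterns [a] and [confN a] on [Y] are equally likely, so this
    probability is a difference of two quantities that are antitone in the volume. *)
Let expect_agreeE K Y a : finite_set K -> expect K \1_(agree Y a) =
  2^-1 * (expect K (triple Y a) - 2 * expect K \1_(agree Y (@conf0 V))).
Proof.
move=> finK; have bi A := @bounded_nonneg_indic A.
rewrite /triple expectD//; last 2 first.
- exact: bounded_nonnegZ.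
- exact: bounded_nonnegD.
rewrite expectZ// expectD//.
have -> : expect K \1_(agree Y (confN a)) = expect K \1_(agree Y a).
  rewrite -expect_confN; apply: eq_expect => n _; rewrite !indicE.
  congr (_ %:R); congr nat_of_bool.
  by apply/idP/idP; rewrite !inE => Hu; apply/agreeN.
by field.
Qed.

(** Convergence along the directed set of finite vertex sets passes to every cofinal sequence of
    finite volumes and is stable under relabelling, so no exhausting sequence is singled out. *)
Definition finite_sets_filter : set_system (set V) :=
  [set P | exists2 K0, finite_set K0 &
    forall K, finite_set K -> K0 `<=` K -> P K].

Global Instance finite_sets_filter_proper : ProperFilter finite_sets_filter.
Proof.
split; first by move=> [K0 finK0 /(_ K0 finK0 (fun x Kx => Kx))].
split.
- by exists set0.
- move=> P Q [K finK PK] [L finL QL]; exists (K `|` L).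
    by rewrite finite_setU.
  by move=> M finM; rewrite subUset => -[KM LM]; split; [exact: PK|exact: QL].
- by move=> P Q PQ [K finK PK]; exists K => // L finL /PK - /(_ finL) /PQ.
Qed.

Lemma antitone_is_cvg (f : set V -> R) : (forall K, finite_set K -> 0 <= f K) ->
  (forall K K', finite_set K -> finite_set K' -> K `<=` K' -> f K' <= f K) ->
  cvg (f K @[K --> finite_sets_filter]).
Proof.
move=> f0 mf; pose A := [set f K | K in finite_set].
have infA : has_inf A.
  split; first by exists (f set0), set0.
  by exists 0 => _ [K finK <-]; exact: f0.
apply/cvg_ex; exists (inf A); apply/cvgrPdist_lt => e e0.
have [_ [K finK <-] fK] := inf_adherent e0 infA.
exists K => // L finL KL.
have : inf A <= f L by apply: ge_inf; [exact: infA.2|exists L].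
by have := mf _ _ finK finL KL; rewrite distrC ltr_norml; lra.
Qed.

Lemma expect_agree_is_cvg Y a :
  cvg (expect K \1_(agree Y a) @[K --> finite_sets_filter]).
Proof.
have [ct c0] : cvg (expect K (triple Y a) @[K --> finite_sets_filter]) /\
    cvg (expect K \1_(agree Y (@conf0 V)) @[K --> finite_sets_filter]).
  split; apply: antitone_is_cvg => [K finK|K K' finK finK' KK'].
  - by apply: expect_ge0; exact: (bounded_triple Y a).1.
  - exact: (expect_antitone finK finK' KK' (bounded_triple Y a)
      (@triple_difference_positive Y a)).
  - by apply: expect_ge0; exact: (bounded_nonneg_indic _).1.
  - exact: (expect_antitone finK finK' KK' (@bounded_nonneg_indic _)
      (@agree0_difference_positive Y)).
move: ct c0 => /cvg_ex[l ct] /cvg_ex[l0 c0].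
apply/cvg_ex; exists (2^-1 * (l - 2 * l0)).
apply: cvg_trans (_ : (2^-1 * (expect K (triple Y a) -
  2 * expect K \1_(agree Y (@conf0 V)))) @[K --> finite_sets_filter] --> _).
  apply: near_eq_cvg; exists set0; first exact: finite_set0.
  by move=> K finK _; rewrite /= -expect_agreeE.
by apply: cvgMr; apply: cvgB => //; exact: cvgMr.
Qed.

(** * A bound on gradients uniform in the volume *)

Lemma gradient_expect_le K x y q : finite_set K -> adj x y -> K x \/ K y ->
  expect K \1_[set n | n x - n y = q] <= 2 * h q / h 0.
Proof.
move=> finK xy Kxy; have [el [uel WE elP]] := weight_prod finK.
wlog xyel : x y q xy Kxy / (x, y) \in el => [H|].
  have [?|yxel] := elP x y xy Kxy; first exact: H.
  have -> : [set n | n x - n y = q] = [set n | n y - n x = - q] :> set (config V).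
    by apply/seteqP; split => n /=; lia.
  by rewrite -[h q]/_ /h -(U_even q); apply: H; rewrite 1?adj_sym// or_comm.
have h0 z : 0 < h z by exact: expR_gt0.
(* [phi] is the weight without the edge {x, y}. Writing [Z z] for the [phi]-mass of [n x - n y = z],
   averaging over boxes yields [Z q + Z (- q) <= 2 * Z 0]; the weight of the event is [h q * Z q],
   and the partition function is at least [h 0 * Z 0]. *)
pose phi n := \prod_(e <- rem (x, y) el) h (n e.1 - n e.2).
have phi0 n : 0 <= phi n by apply: prodr_ge0 => e _; exact: ltW.
have WphiE n : weight K n = h (n x - n y) * phi n.
  by rewrite WE (perm_big _ (perm_to_rem xyel)) big_cons.
pose d z (n : config V) : R := (n x - n y == z)%:R.
pose a n := phi n * (2 * d 0 n).
pose b n := phi n * (d q n + d (- q) n).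
have d0 z n : 0 <= d z n by [].
have ab : (mass K b <= mass K a)%E.
  apply: positive_definite_mass_le => //.
  - by move=> n; rewrite /a !mulr_ge0.
  - by move=> n; rewrite /b mulr_ge0 ?addr_ge0.
  have pphi : posker (fun u v : config V => phi (confB u v)).
    have := @posker_prod R (config V) _ (rem (x, y) el) (fun e u v =>
      h (confB u v e.1 - confB u v e.2)).
    apply=> e _.
    have := posker_comp (fun u : config V => u e.1 - u e.2) h_pd.
    by apply: posker_ext => u v; congr h; rewrite /confB; lia.
  have pd := posker_double (fun b : bool => (-1) ^+ b : R)
    (fun (b : bool) z => if b then z + q else z) (@posker_eq R int).
  have := poskerM pphi (posker_comp (fun u : config V => u x - u y) pd).
  apply: posker_ext => u v; rewrite !big_bool/= !expr1 !expr0 /a /b /d.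
  rewrite -mulrBr; congr (_ * _); rewrite /confB.
  have -> : (u x - u y + q == v x - v y + q) = (u x - v x - (u y - v y) == 0).
    by lia.
  have -> : (u x - u y == v x - v y) = (u x - v x - (u y - v y) == 0) by lia.
  have -> : (u x - u y + q == v x - v y) = (u x - v x - (u y - v y) == - q).
    by lia.
  have -> : (u x - u y == v x - v y + q) = (u x - v x - (u y - v y) == q).
    by lia.
  by ring.
have indE z n : \1_[set n | n x - n y = z] n = d z n :> R.
  by rewrite indicE /d; congr (_%:R); congr nat_of_bool; apply/idP/eqP;
    rewrite inE.
have le : (mass K (fun n => weight K n * \1_[set n | n x - n y = q] n)%R <=
    (2 * h q / h 0)%:E * mass K (weight K))%E.
  apply: (@le_trans _ _ ((h q)%:E * mass K b)%E).
    rewrite /mass -esumZl; last 2 first.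
    - exact: ltW.
    - by move=> n _; rewrite lee_fin mulr_ge0 ?addr_ge0.
    apply: le_esum => n _; rewrite -EFinM lee_fin indE WphiE /b /d.
    case: eqP => [->|_]; last first.
      rewrite mulr0; apply: mulr_ge0; first exact: ltW.
      by apply: mulr_ge0 => //; exact: addr_ge0.
    by rewrite mulr1 ler_pM2l// ler_peMr// lerDl.
  apply: (@le_trans _ _ ((h q)%:E * mass K a)%E).
    by rewrite lee_pmul2l// lte_fin.
  have -> : 2 * h q / h 0 = h q * (2 / h 0) by ring.
  rewrite EFinM -muleA lee_pmul2l ?lte_fin//.
  have r0 : 0 <= 2 / h 0 by rewrite divr_ge0 ?ltW.
  rewrite /mass -esumZl//; last by move=> n _; rewrite lee_fin expR_ge0.
  apply: le_esum => n _; rewrite -EFinM lee_fin WphiE /a /d.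
  case: eqP => [->|_]; last by rewrite !mulr0 mulr_ge0// mulr_ge0// ltW.
  by rewrite mulr1 [phi n * 2]mulrC mulrA divfK// gt_eqF.
rewrite /expect ler_pdivrMr ?Wmass_gt0//.
rewrite -lee_fin EFinM !fineK ?Wmass_fin ?mass_bounded_fin//.
exact: bounded_nonneg_indic.
Qed.

Lemma expect_sum K (I : Type) (s : seq I) (a : I -> R)
    (F : I -> config V -> R) : finite_set K -> (forall i, 0 <= a i) ->
  (forall i, bounded_nonneg (F i)) ->
  expect K (fun n => \sum_(i <- s) a i * F i n) =
  \sum_(i <- s) a i * expect K (F i).
Proof.
move=> finK a0 bF.
suff [_ ->] : bounded_nonneg (fun n => \sum_(i <- s) a i * F i n) /\
    expect K (fun n => \sum_(i <- s) a i * F i n) =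
    \sum_(i <- s) a i * expect K (F i) by [].
elim: s => [|i s [bs IH]].
  rewrite big_nil (_ : (fun n => _) = fun=> 0 * 1).
    split; first exact/bounded_nonnegZ/bounded_nonneg_cst.
    by rewrite expectZ ?mul0r//; exact: bounded_nonneg_cst.
  by apply/funext => n; rewrite big_nil mul0r.
rewrite (_ : (fun n => _) = fun n => a i * F i n + \sum_(i <- s) a i * F i n).
  split; first by apply: bounded_nonnegD => //; exact: bounded_nonnegZ.
  by rewrite expectD ?expectZ ?IH ?big_cons//; exact: bounded_nonnegZ.
by apply/funext => n; rewrite big_cons.
Qed.

Lemma expect_indic_le K (A B D : set (config V)) : finite_set K ->
  (forall n, supported_in K n -> A n -> B n \/ D n) ->
  expect K \1_A <= expect K \1_B + expect K \1_D.
Proof.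
move=> finK ABD; have bi (X : set (config V)) := @bounded_nonneg_indic X.
rewrite -expectD//; apply: le_expect => //; first exact: bounded_nonnegD.
move=> n Kn; rewrite !indicE; case: (boolP (n \in A)); last first.
  by move=> _; rewrite addr_ge0.
by rewrite inE => /ABD - /(_ Kn)[/mem_set ->|/mem_set ->];
  rewrite ?lerDl ?lerDr.
Qed.

(** * Tightness uniformly over all finite volumes *)

Definition tail x J : set (config V) := [set n | (J < `|n x|)%N].

Definition tight_at x := forall e : R, 0 < e -> exists J, forall K,
  finite_set K -> expect K \1_(tail x J) <= e.

Lemma gradient_tight x y e : adj x y -> 0 < e -> exists J, forall K,
  finite_set K ->
  expect K \1_[set n : config V | (J < `|(n x - n y)%R|)%N] <= e.
Proof.
(* The growth of [U] gives [h k <= expR C * r ^+ k]; the 4 in [D] is the 2 of the gradient bound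
   times the two signs of the gradient. *)
move=> xy e0; pose r := expR (- c); pose D := 4 * expR C / h 0.
have D0 : 0 <= D by rewrite divr_ge0 ?mulr_ge0 ?expR_ge0.
have r0 : 0 <= r by exact: expR_ge0.
have r1 : r < 1 by rewrite expR_lt1 oppr_lt0.
have hle (k : nat) : h k%:Z <= expR C * r ^+ k.
  rewrite -expRM_natl -expRD ler_expR mulrN.
  have := U_growth k%:Z; rewrite ger0_norm ?ler0z// -pmulrn.
  by rewrite mulrC; move: (_ * c) => z; lra.
have [J DJ] : exists J, D * r ^+ J / (1 - r) <= e.
  have : D * r ^+ J / (1 - r) @[J --> \oo] --> D * 0 / (1 - r).
    by apply: cvgMl; apply: cvgMr; apply: cvg_expr; rewrite ger0_norm.
  rewrite mulr0 mul0r => /cvgrPdist_le/(_ e e0) [J _ /(_ J (leqnn _))].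
  rewrite sub0r normrN ger0_norm; first by exists J.
  by rewrite divr_ge0 ?subr_ge0 ?(ltW r1)// mulr_ge0// exprn_ge0.
exists J => K finK.
pose A k : set (config V) := [set n | `|(n x - n y)%R|%N = (J + k).+1].
have Ale k : expect K \1_(A k) <= D * r ^+ J * r ^+ k.
  have Dr0 : 0 <= D * r ^+ J * r ^+ k.
    by apply: mulr_ge0; [apply: mulr_ge0 => //|]; exact: exprn_ge0.
  have [Kxy|/not_orP[Kx Ky]] := pselect (K x \/ K y); last first.
    rewrite (eq_expect (H := fun=> 0 * 1)); last first.
      move=> n Kn; rewrite mul0r indicE memNset//.
      by rewrite /A /= !Kn.
    by rewrite expectZ ?mul0r//; exact: bounded_nonneg_cst.
  have hk := hle (J + k).+1.
  apply: (@le_trans _ _ (2 * h (J + k).+1%:Z / h 0 +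
                         2 * h (- (J + k).+1%:Z) / h 0)).
    apply: le_trans (lerD (gradient_expect_le _ finK xy Kxy)
      (gradient_expect_le _ finK xy Kxy)).
    by apply: expect_indic_le => // n _ /=; rewrite /A/=; lia.
  have -> : h (- (J + k).+1%:Z) = h (J + k).+1%:Z by rewrite /h U_even.
  rewrite /D -mulrDl -!mulrA [(h 0)^-1 * _]mulrC !mulrA ler_pM2r ?invr_gt0 ?expR_gt0//.
  rewrite exprS exprD in hk.
  have : expR C * (r * (r ^+ J * r ^+ k)) <= expR C * (1 * (r ^+ J * r ^+ k)).
    apply: ler_wpM2l; first exact: expR_ge0.
    apply: ler_wpM2r; last exact: ltW.
    by apply: mulr_ge0; exact: exprn_ge0.
  by move: hk; move: (expR C) (h _) (r ^+ J) (r ^+ k) => a b d f; lra.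
have AE : [set n : config V | (J < `|(n x - n y)%R|)%N] = \bigcup_k A k.
  apply/seteqP; split => n /= => [Jn|[k _]]; last by rewrite /A/=; lia.
  by exists (`|(n x - n y)%R|%N - J.+1)%N => //; rewrite /A /=; lia.
have massE (B : set (config V)) : mass K (fun n => weight K n * \1_B n) =
    (\esum_(n in supported_in K `&` B) (weight K n)%:E)%E.
  rewrite esum_mkcondr; apply: eq_esum => n _; rewrite indicE.
  by case: ifPn; rewrite ?mulr1 ?mulr0.
rewrite AE /expect ler_pdivrMr ?Wmass_gt0// -lee_fin EFinM.
rewrite fineK ?mass_bounded_fin//; last exact: bounded_nonneg_indic.
rewrite massE setI_bigcupr nneseries_sum_bigcup; last 2 first.
- by move=> i j _ _ [n [[_ +] [_]]]; rewrite /A/=; lia.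
- by move=> n; rewrite lee_fin expR_ge0.
apply: lime_le; first by apply: is_cvg_nneseries => k _ _; rewrite -massE;
  apply: mass_ge0 => n; rewrite mulr_ge0 ?expR_ge0// indicE.
apply: nearW => N.
under eq_bigr => k _ do rewrite -massE
  -(fineK (mass_bounded_fin finK (@bounded_nonneg_indic (A k)))).
rewrite sumEFin -EFinM lee_fin.
apply: le_trans (_ : D * r ^+ J / (1 - r) * fine (mass K (weight K)) <= _).
  rewrite -ler_pdivrMr ?Wmass_gt0// mulr_suml.
  rewrite big_mkord; apply: (@le_trans _ _ (\sum_(i < N) D * r ^+ J * r ^+ i)).
    by apply: ler_sum => i _; exact: Ale.
  rewrite -mulr_sumr; apply: ler_wpM2l.
    by apply: mulr_ge0 => //; exact: exprn_ge0.
  exact: sum_geometric_le.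
by rewrite ler_wpM2r// ltW// Wmass_gt0.
Qed.

Lemma tight_at_adj x y : adj x y -> tight_at x -> tight_at y.
Proof.
move=> xy tx e e0; have e20 : 0 < e / 2 by rewrite divr_gt0.
have [J HJ] := tx _ e20; have [J' HJ'] := gradient_tight xy e20.
exists (J + J')%N => K finK; rewrite [leRHS]splitr.
apply: le_trans (lerD (HJ K finK) (HJ' K finK)).
by apply: expect_indic_le => // n _; rewrite /tail/=; lia.
Qed.

Lemma tight_at_all x y : tight_at x -> tight_at y.
Proof.
have [p + <-] := adj_conn x y; elim: p x => [//|z p IH] x /= /andP[xz zp] tx.
by apply: IH => //; exact: tight_at_adj tx.
Qed.

Lemma expect_cst K a : finite_set K -> 0 <= a -> expect K (fun=> a) = a.
Proof.
move=> finK a0; rewrite -[RHS]mulr1 -(expect1 finK) -expectZ//.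
  by apply: eq_expect => n _; rewrite mulr1.
exact: bounded_nonneg_cst.
Qed.

(** Monotonicity in the volume holds for the Gaussian [F], which is positive definite. A volume [K']
    of the cofinal family containing [K] gives [expect K F >= expect K' F >= 1 - 2d], and as
    [F <= d] on a far tail, that tail has probability at most [3d] in [K]. *)
Lemma tight_at_cofinal x :
  (forall e : R, 0 < e -> exists J, forall K0, finite_set K0 ->
    exists2 K, finite_set K /\ K0 `<=` K & expect K \1_(tail x J) <= e) ->
  tight_at x.
Proof.
move=> tx e e0; pose d := e / 3; have d0 : 0 < d by rewrite divr_gt0.
(* This choice of [a] gives [a * J ^ 2 / 2 <= d], so that [F >= 1 - d] where [|n x| <= J]. *)
have [J HJ] := tx d d0; pose a := d / (J%:R ^+ 2 + 1).
have a0 : 0 < a by rewrite divr_gt0// ltr_wpDl// sqr_ge0.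
pose F (n : config V) : R := expR (- (2^-1 * a * ((n x)%:~R) ^+ 2)).
have F1 n : F n <= 1.
  by rewrite -expR0 ler_expR oppr_le0 mulr_ge0 ?sqr_ge0// mulr_ge0// ltW.
have bF : bounded_nonneg F by split; [move=> n; exact: expR_ge0|exists 1].
have pF : difference_positive F.
  apply: even_positive_definite.
    by move=> n; rewrite /F /confN intrN sqrrN.
  have := posker_comp (fun n : config V => n x) (posker_gauss (ltW a0)).
  exact: posker_ext.
have bi (X : set (config V)) := @bounded_nonneg_indic X.
pose m (k : nat) : R := expR (- (2^-1 * a * k%:R ^+ 2)).
have intn (n : config V) : ((n x)%:~R : R) ^+ 2 = `|n x|%N%:R ^+ 2.
  by rewrite natr_absz intr_norm real_normK// num_real.
have lower K k : finite_set K -> m k <= expect K F + expect K \1_(tail x k).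
  move=> finK; have m0 : 0 <= m k by exact: expR_ge0.
  rewrite -{1}(expect_cst finK m0) -expectD//; apply: le_expect => //.
  - exact: bounded_nonneg_cst.
  - exact: bounded_nonnegD.
  move=> n _; rewrite indicE; case: (boolP (n \in _)) => [_|].
    rewrite -[m k]add0r; apply: lerD; first exact: expR_ge0.
    by rewrite -expR0 ler_expR oppr_le0 mulr_ge0 ?sqr_ge0// mulr_ge0// ltW.
  rewrite notin_setE /tail/= => /negP; rewrite -leqNgt => nk.
  rewrite addr0 ler_expR lerN2; apply: ler_wpM2l; first by rewrite mulr_ge0// ltW.
  by rewrite intn ler_sqr ?nnegrE// ler_nat.
have upper K k : finite_set K -> expect K F + expect K \1_(tail x k) <= 1 + m k.
  move=> finK; have m0 : 0 <= m k by exact: expR_ge0.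
  have m1 : 0 <= 1 + m k by rewrite addr_ge0.
  rewrite -expectD// -(expect_cst finK m1); apply: le_expect => //.
  - exact: bounded_nonnegD.
  - exact: bounded_nonneg_cst.
  move=> n _; rewrite indicE; case: (boolP (n \in _)) => [|_]; last first.
    by rewrite addr0; apply: le_trans (F1 n) _; rewrite lerDl.
  rewrite inE /tail/= => kn; rewrite addrC lerD2l ler_expR lerN2.
  apply: ler_wpM2l; first by rewrite mulr_ge0// ltW.
  by rewrite intn ler_sqr ?nnegrE// ler_nat ltnW.
have mJ : 1 - m J <= d.
  have := expR_ge1Dx (- (2^-1 * a * J%:R ^+ 2)); rewrite -/(m J).
  have : a * (J%:R ^+ 2 + 1) = d by rewrite /a divfK// gt_eqF// ltr_wpDl// sqr_ge0.
  have := sqr_ge0 (J%:R : R); move: (J%:R ^+ 2) (m J) => j z; nra.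
(* Large enough for [a * J' ^ 2 * d / 2 >= 1], whence [m J' <= d] by [expR y >= 1 + y]. *)
pose J' := (Num.bound (2 / (a * d))).+1.
have mJ' : m J' <= d.
  have Jb : 2 / (a * d) <= J'%:R ^+ 2.
    have : 2 / (a * d) <= J'%:R.
      apply: ltW; apply: lt_le_trans (archi_boundP _) _.
        by rewrite divr_ge0// mulr_ge0 ?ltW.
      by rewrite ler_nat.
    move/le_trans; apply; rewrite expr2 ler_peMr//.
    by rewrite -[leLHS]/(1%:R) ler_nat.
  have ad : 1 <= 2^-1 * a * J'%:R ^+ 2 * d.
    have ad0 : 0 < a * d by rewrite mulr_gt0.
    move: Jb; rewrite ler_pdivrMr//; move: (J'%:R ^+ 2) => j; lra.
  rewrite /m expRN -[leRHS]invrK lef_pV2 ?posrE ?expR_gt0 ?invr_gt0//.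
  apply: le_trans (expR_ge1Dx _); rewrite -[leLHS]mul1r ler_pdivrMr//.
  by rewrite mulrDl mul1r; apply: le_trans ad _; rewrite lerDr ltW.
exists J' => K finK; have [K' [finK' KK'] HK'] := HJ K finK.
have := expect_antitone finK finK' KK' bF pF.
have := lower K' J finK'; have := upper K J' finK.
have e3 : e = d + d + d by rewrite /d; field.
rewrite e3; move: mJ mJ' HK'; move: (m J) (m J') (expect K' F) (expect K F).
by clearbody d; move: (expect K' _) (expect K _) => *; lra.
Qed.

(** * Limits of cylinder probabilities and the limiting measure *)

Lemma le_expect_indic K (A B : set (config V)) : finite_set K ->
  (forall n, supported_in K n -> A n -> B n) -> expect K \1_A <= expect K \1_B.
Proof.
move=> finK AB; apply: le_expect => //; try exact: bounded_nonneg_indic.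
move=> n Kn; rewrite !indicE; case: (boolP (n \in A)) => //.
by rewrite inE => /(AB _ Kn)/mem_set ->.
Qed.

Lemma expect_indic0 K : finite_set K -> expect K \1_set0 = 0.
Proof.
move=> finK; rewrite (eq_expect (H := fun=> 0 * 1)).
  by rewrite expectZ ?mul0r//; exact: bounded_nonneg_cst.
by move=> n _; rewrite indic0 mul0r.
Qed.

Lemma uniform_tail Y e : finite_set Y -> (forall x, tight_at x) -> 0 < e ->
  exists J, forall K, finite_set K ->
    expect K \1_[set n | exists2 x, Y x & tail x J n] <= e.
Proof.
move=> finY tight; have -> : Y = [set` fset_set Y] by rewrite fset_setK.
elim/finSet_rect: (fset_set Y) e => s IH e e0.
have [->|[x xs]] := fset_0Vmem s.
  exists 0%N => K finK; rewrite (_ : [set n | _] = set0) ?expect_indic0 ?ltW//.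
  by apply/seteqP; split => // n [x].
have e20 : 0 < e / 2 by rewrite divr_gt0.
have [J HJ] := tight x _ e20.
have [J' HJ'] := IH (s `\ x)%fset (fproperD1 xs) _ e20.
exists (J + J')%N => K finK; rewrite [leRHS]splitr.
apply: le_trans (lerD (HJ K finK) (HJ' K finK)).
apply: expect_indic_le => // n _ [y /= ys]; rewrite /tail/= => yJ.
have [yx|yx] := eqVneq y x; [left; rewrite -yx; lia|right; exists y; last by lia].
by rewrite /= !inE yx.
Qed.

(** Cut off by bounded heights on [Y], the event is a finite union of patterns, whose probabilities
    converge. The part cut off is small uniformly in the volume, so the whole is Cauchy. *)
Lemma expect_cylinder_is_cvg Y (A : set (config V)) : finite_set Y ->
  (forall x, tight_at x) -> determined_by Y A ->
  cvg (expect K \1_A @[K --> finite_sets_filter]).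
Proof.
move=> finY tight AY.
pose B J : set (config V) := A `&` [set n | forall x, Y x -> (`|n x| <= J)%N].
have cvgB J : cvg (expect K \1_(B J) @[K --> finite_sets_filter]).
  pose box (g : {ffun fset_set Y -> 'I_(J + J.+1)}) : config V :=
    conf_of_ffun [ffun i => (g i)%:Z - J%:Z].
  have BE : \1_(B J) = fun n => \sum_(g : {ffun fset_set Y -> 'I_(J + J.+1)})
      \1_A (box g) * \1_(agree Y (box g)) n :> R.
    apply/funext => n; rewrite indicE; have [Bn|Bn] := pselect (B J n).
      have lt (i : fset_set Y) : (`|(n (val i) + J%:Z)%R| < J + J.+1)%N.
        have Yi : Y (val i) by have := valP i; rewrite in_fset_set// inE.
        by have := Bn.2 _ Yi; lia.
      pose g := [ffun i => Ordinal (lt i)].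
      have gn : agree Y (box g) n.
        move=> x Yx; have xY : x \in fset_set Y by rewrite in_fset_set// inE.
        rewrite -[x]/(val (FSetSub xY)) /box conf_of_ffunE !ffunE/=.
        by have := Bn.2 _ Yx; lia.
      rewrite mem_set// (bigD1 g)//= !indicE (mem_set gn) mulr1.
      rewrite mem_set; last by apply: AY Bn.1 => x /gn.
      rewrite big1 ?addr0// => g' gg'; rewrite !indicE [n \in _]memNset ?mulr0//.
      move=> g'n; move/negP: gg'; apply; apply/eqP/ffunP => i; apply/val_inj.
      have Yi : Y (val i) by have := valP i; rewrite in_fset_set// inE.
      by have := g'n _ Yi; rewrite (gn _ Yi) /box !conf_of_ffunE !ffunE/=; lia.
    rewrite memNset// big1// => g _; rewrite !indicE.
    have [Ag|Ag] := pselect (A (box g)); last by rewrite memNset// mul0r.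
    rewrite [n \in _]memNset ?mulr0// => gn; apply: Bn; split.
      by apply: AY Ag => x /gn.
    move=> x Yx; rewrite (gn _ Yx).
    have xY : x \in fset_set Y by rewrite in_fset_set// inE.
    rewrite -[x]/(val (FSetSub xY)) /box conf_of_ffunE ffunE.
    by have := ltn_ord (g (FSetSub xY)); move: (nat_of_ord _) => z; lia.
  have bi (X : set (config V)) := @bounded_nonneg_indic X.
  have /choice[l lP] : forall g : {ffun fset_set Y -> 'I_(J + J.+1)}, exists l : R,
      expect K \1_(agree Y (box g)) @[K --> finite_sets_filter] --> l.
    by move=> g; apply/cvg_ex; exact: expect_agree_is_cvg.
  apply/cvg_ex; exists (\sum_g \1_A (box g) * l g).
  apply: (@cvg_trans _ ((\sum_g \1_A (box g) * expect K \1_(agree Y (box g)))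
      @[K --> finite_sets_filter])).
    apply: near_eq_cvg; exists set0; first exact: finite_set0.
    move=> K finK _; rewrite /= BE expect_sum// => g; rewrite indicE.
  apply: cvg_big => [|g _]; first exact: add_continuous.
  exact: cvgMr.
apply/cauchy_cvgP/cauchy_exP => e e0.
have e20 : 0 < e / 2 by rewrite divr_gt0.
have [J HJ] := uniform_tail finY tight e20.
have /cvg_ex[l lP] := cvgB J; exists l.
have [K0 finK0 HK0] := (cvgrPdist_lt _ _).1 lP _ e20.
exists K0 => // K finK K0K; rewrite -ball_normE/=.
have le1 : expect K \1_(B J) <= expect K \1_A.
  by apply: le_expect_indic => // n _ [].
have le2 : expect K \1_A <= expect K \1_(B J) +
    expect K \1_[set n | exists2 x, Y x & tail x J n].
  apply: expect_indic_le => // n _ An.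
  have [H|/existsNP[x /not_implyP[Yx /negP]]] :=
    pselect (forall x, Y x -> (`|n x| <= J)%N); first by left.
  by rewrite -ltnNge => nx; right; exists x.
have := HK0 K finK K0K; have := HJ K finK.
by rewrite !ltr_norml; lra.
Qed.

Lemma mass_indic K (B : set (config V)) :
  mass K (fun n => weight K n * \1_B n) =
  (\esum_(n in supported_in K `&` B) (weight K n)%:E)%E.
Proof.
rewrite esum_mkcondr; apply: eq_esum => n _; rewrite indicE.
by case: ifPn; rewrite ?mulr1 ?mulr0.
Qed.

Lemma finite_sets_limit_eq (f g : set V -> R) (l l' : R) :
  (\forall K \near finite_sets_filter, f K = g K) ->
  f K @[K --> finite_sets_filter] --> l ->
  g K @[K --> finite_sets_filter] --> l' -> l = l'.
Proof.
move=> fg fl gl; have fl' : f K @[K --> finite_sets_filter] --> l'.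
  by apply: cvg_trans gl; apply: near_eq_cvg; apply: filterS fg => K.
exact: (cvg_unique (@norm_hausdorff _ R) fl fl').
Qed.

Lemma infinite_volume_measure : countable [set: V] ->
  (forall x, tight_at x) -> exists P : probability (config V) R,
  forall A, cylinder_event A ->
    expect K \1_A @[K --> finite_sets_filter] --> fine (P A).
Proof.
move=> V_countable tight.
(* The extension asks for nonnegativity on all sets, also those for which the limit may be a default
   value; hence the absolute value. *)
pose m A : R := `|lim (expect K \1_A @[K --> finite_sets_filter])|.
have mlim A : cylinder_event A ->
    expect K \1_A @[K --> finite_sets_filter] --> m A.
  move=> [Y finY AY]; have cA := expect_cylinder_is_cvg finY tight AY.
  rewrite /m ger0_norm//; apply: limr_ge => //.
  by exists set0 => // K _ _; apply: expect_ge0; exact: (bounded_nonneg_indic A).1.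
have cT : cylinder_event [set: config V] by exists set0; [exact: finite_set0|].
have [||A B cA cB AB|x e e0||P PE] := @cylinder_extension R V m.
- by move=> A; exact: normr_ge0.
- apply: finite_sets_limit_eq (mlim _ cT) (cvg_cst (1 : R)).
  exists set0; first exact: finite_set0.
  move=> K finK _; rewrite -[RHS](expect1 finK); apply: eq_expect => n _.
  by rewrite indicT.
- have cAB := cylinder_eventU cA cB.
  apply: finite_sets_limit_eq (mlim _ cAB) (cvgD (mlim _ cA) (mlim _ cB)).
  exists set0; first exact: finite_set0.
  move=> K finK _; rewrite /= -expectD; [|by []|exact: bounded_nonneg_indic..].
  apply: eq_expect => n _; rewrite !indicE in_setU.
  case: (boolP (n \in A)) => An; case: (boolP (n \in B)) => Bn;
    rewrite ?addr0 ?add0r//.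
  by move: An Bn; rewrite !inE => An Bn; have : (A `&` B) n by []; rewrite AB.
- have [J HJ] := tight x e e0; exists J.
  have ct : cylinder_event (tail x J).
    by exists [set x]; [exact: finite_set1|move=> n n' nn'; rewrite /tail/= nn'].
  rewrite -/(tail x J) -(cvg_lim (@norm_hausdorff _ R) (mlim _ ct)).
  apply: limr_le; first exact: cvgP (mlim _ ct).
  by exists set0; [exact: finite_set0|move=> K finK _; exact: HJ].
- exact: V_countable.
by exists P => A cA; rewrite PE//=; exact: mlim.
Qed.

(** * The specification and the DLR equations *)

Definition neighborhood S : set V := S `|` [set y | exists2 x, S x & adj x y].

Lemma finite_neighborhood S : finite_set S -> finite_set (neighborhood S).
Proof.
move=> finS; rewrite finite_setU; split => //.
have -> : [set y | exists2 x, S x & adj x y] =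
    \bigcup_(x in S) [set y | adj x y] by [].
exact: bigcup_finite.
Qed.

Lemma edges_meeting_neighborhood S e : edges_meeting adj S e ->
  neighborhood S e.1 /\ neighborhood S e.2.
Proof.
move=> [ea [Se|Se]]; split; [by left|by right; exists e.1| |by left].
by right; exists e.2; rewrite // adj_sym.
Qed.

Lemma weight_determined S n m : (forall x, neighborhood S x -> n x = m x) ->
  weight S n = weight S m.
Proof.
move=> nm; rewrite /weight; congr (expR (- _)); apply: eq_energy => e Ee.
by have [/nm -> /nm ->] := edges_meeting_neighborhood Ee.
Qed.

Definition outside_partition S eta : R :=
  fine (\esum_(n in outside_agree S eta) (weight S n)%:E)%E.

Lemma outside_partitionK S eta : finite_set S ->
  (outside_partition S eta)%:E =
  (\esum_(n in outside_agree S eta) (weight S n)%:E)%E.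
Proof.
move=> finS; rewrite fineK// ge0_fin_numE ?weight_mass_fin//.
by apply: esum_ge0 => n _; rewrite lee_fin weight_ge0.
Qed.

Lemma outside_partition_gt0 S eta : finite_set S -> 0 < outside_partition S eta.
Proof. by move=> finS; rewrite -lte_fin outside_partitionK// weight_mass_gt0. Qed.

Lemma glue_determined S n eta eta' :
  (forall x, neighborhood S x -> ~ S x -> eta x = eta' x) ->
  weight S (glue S n eta) = weight S (glue S n eta').
Proof.
move=> ee; apply: weight_determined => x Nx; rewrite /glue; case: ifPn => //.
by rewrite notin_setE => /(ee _ Nx).
Qed.

Lemma outside_partition_glue S eta : finite_set S ->
  (outside_partition S eta)%:E =
  (\esum_(n in supported_in S) (weight S (glue S n eta))%:E)%E.
Proof.
by move=> finS; rewrite outside_partitionK// (reindex_esum _ _ _ _ (glue_bij S eta)).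
Qed.

Lemma outside_partition_determined S eta eta' : finite_set S ->
  (forall x, neighborhood S x -> ~ S x -> eta x = eta' x) ->
  outside_partition S eta = outside_partition S eta'.
Proof.
move=> finS ee; apply: EFin_inj; rewrite !outside_partition_glue//.
by apply: eq_esum => n _; rewrite (glue_determined _ ee).
Qed.

Lemma specificationE S eta (A : set (config V)) : finite_set S ->
  specification U adj S eta A =
  ((\esum_(n in A `&` outside_agree S eta) (weight S n)%:E) *
    ((outside_partition S eta)^-1)%:E)%E.
Proof.
move=> finS; rewrite /specification /= /mnormalize /=.
have -> : boltzmann U (edges_meeting adj S)
    [set n : config V | forall x, ~ S x -> n x = eta x] setT =
    (outside_partition S eta)%:E.
  by rewrite outside_partitionK// /boltzmann setTI.
by rewrite eqe gt_eqF ?outside_partition_gt0.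
Qed.

(** Once the window contains [S] and its neighbors, a pattern on it compatible with [eta] leaves a
    single configuration, whose weight and normalization depend on [a] alone. The specification thus
    becomes a local function of [eta]. *)
Lemma specification_agree S Y a eta : finite_set S -> neighborhood S `<=` Y ->
  specification U adj S eta (agree Y a) =
  (weight S a / outside_partition S a * \1_(agree (Y `\` S) a) eta)%:E.
Proof.
move=> finS SY; rewrite specificationE// indicE.
have SY' : S `<=` Y by move=> x Sx; apply: SY; left.
have [ea|ea] := pselect (agree (Y `\` S) a eta); last first.
  rewrite memNset// mulr0 (_ : _ `&` _ = set0) ?esum_set0 ?mul0e//.
  apply/seteqP; split => // n [na ne]; apply: ea => x [Yx Sx].
  by rewrite -(ne x Sx) na.
rewrite mem_set// mulr1.
have -> : agree Y a `&` outside_agree S eta = [set glue S a eta].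
  apply/seteqP; split => [n [na ne]|_ ->].
    apply/funext => x; rewrite /glue; case: ifPn.
      by rewrite inE => /SY' /na.
    by rewrite notin_setE => /ne.
  split => x.
    move=> Yx; rewrite /glue; case: ifPn => //; rewrite notin_setE => Sx.
    by apply: ea; split.
  by move=> Sx; rewrite /glue memNset.
rewrite esum_set1 ?lee_fin ?weight_ge0// -EFinM.
rewrite (@outside_partition_determined S eta a)//; last first.
  by move=> x /SY Yx Sx; apply: ea; split.
congr (_ / _)%:E; apply: weight_determined => x /SY Yx; rewrite /glue.
by case: ifPn => //; rewrite notin_setE => Sx; apply: ea; split.
Qed.

(** The weight splits into [weight S] and a factor [rest] blind to the heights in [S]. Once the
    heights on [Y] outside of [S] are fixed, summing over the heights in [S] turns [weight S] into
    [outside_partition S a]. *)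
Lemma expect_agree_dlr S Y a K : finite_set S -> finite_set K ->
  neighborhood S `<=` Y -> Y `<=` K ->
  expect K \1_(agree Y a) =
  weight S a / outside_partition S a * expect K \1_(agree (Y `\` S) a).
Proof.
move=> finS finK SY YK.
have SY' : S `<=` Y by move=> x Sx; apply: SY; left.
pose rest n : R := expR (- energy U (edges_meeting adj K `\` edges_meeting adj S) n).
have rest0 n : 0 <= rest n by exact: expR_ge0.
have SK : edges_meeting adj S `<=` edges_meeting adj K.
  by move=> e [ea [Se|Se]]; split => //; [left|right]; exact/YK/SY'.
have WE n : weight K n = weight S n * rest n.
  by rewrite /weight (energy_setD n (edges_meeting_finite finK) SK) opprD expRD.
pose D := supported_in K `&` agree Y a.
pose r := (\esum_(n in D) (rest n)%:E)%E.
have WS0 := weight_gt0 S a.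
have WD n : D n -> weight S n = weight S a.
  by move=> [_ na]; apply: weight_determined => x /SY; exact: na.
have massY : mass K (fun n => weight K n * \1_(agree Y a) n) =
    ((weight S a)%:E * r)%E.
  rewrite mass_indic /r -esumZl ?ltW//; last by move=> n _; rewrite lee_fin.
  by apply: eq_esum => n Dn; rewrite WE WD.
have rfin : r \is a fin_num.
  have : mass K (fun n => weight K n * \1_(agree Y a) n) \is a fin_num.
    by apply: mass_bounded_fin => //; exact: bounded_nonneg_indic.
  rewrite massY; have : (0 <= r)%E.
    by apply: esum_ge0 => n _; rewrite lee_fin.
  by case: (r) => // _; rewrite gt0_muley// lte_fin.
(* A configuration whose pattern is prescribed on [Y] outside of [S] amounts to free heights on [S]
   together with a configuration having the full pattern on [Y]. *)
have bij : set_bij (supported_in S `*` D)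
    (supported_in K `&` agree (Y `\` S) a) (fun p => glue S p.1 p.2).
  split.
  - move=> [s n] [/= Ss [Kn na]]; split => x.
      by move=> Kx; rewrite /glue memNset ?Kn// => /SY' /YK.
    by move=> [Yx Sx]; rewrite /glue memNset// na.
  - move=> [s n] [s' n']; rewrite !inE => -[/= Ss [Kn na]] [/= Ss' [Kn' na']].
    move=> /funeqP E; congr (_, _); apply/funext => x.
      have [Sx|Sx] := pselect (S x); last by rewrite Ss// Ss'.
      by have := E x; rewrite /glue mem_set.
    have [Sx|Sx] := pselect (S x); last by have := E x; rewrite /glue memNset.
    by rewrite na ?na'//; exact: SY'.
  - move=> m [Km ma]; exists (glue S m (@conf0 V), glue S a m).
      split; first by move=> x Sx; rewrite /= /glue memNset.
      split => x.
        by move=> Kx; rewrite /= /glue memNset ?Km// => /SY' /YK.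
      move=> Yx; rewrite /= /glue; case: ifPn => //; rewrite notin_setE => Sx.
      by apply: ma; split.
    by apply/funext => x; rewrite /= /glue; case: (x \in S).
have massYS : mass K (fun n => weight K n * \1_(agree (Y `\` S) a) n) =
    ((outside_partition S a)%:E * r)%E.
  rewrite mass_indic (reindex_esum _ _ _ _ bij) outside_partition_glue//.
  rewrite /r -esumM//.
  - apply: eq_esum => -[s n] [/= Ss [Kn na]]; rewrite WE; congr (_ * _)%:E.
      by apply: glue_determined => x /SY Yx _; exact: na.
    rewrite /rest; congr (expR (- _)); apply: eq_energy => e [[ea _] nSe].
    rewrite /glue !memNset// => Se; apply: nSe; split => //; first by right.
    by left.
  - by move=> s; exact: weight_ge0.
  - by rewrite ltey_eq rfin.
rewrite /expect massY massYS !fineM//=.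
by field; rewrite !gt_eqF ?outside_partition_gt0 ?Wmass_gt0.
Qed.

Section infinite_volume.
Variable P : probability (config V) R.
Hypothesis P_limit : forall A, cylinder_event A ->
  expect K \1_A @[K --> finite_sets_filter] --> fine (P A).

Let cylinder_agree Y a : finite_set Y -> cylinder_event (agree Y a).
Proof. by move=> finY; exists Y => //; exact: determined_by_agree. Qed.

Let agree_dlr S Y a : finite_set S -> finite_set Y -> neighborhood S `<=` Y ->
  P (agree Y a) = ((weight S a / outside_partition S a)%:E *
    P (agree (Y `\` S) a))%E.
Proof.
move=> finS finY SY.
have PE A : cylinder_event A -> P A = (fine (P A))%:E.
  by move=> cA; rewrite fineK// fin_num_measure//; exact: measurable_cylinder_event.
have cY : cylinder_event (agree Y a) by exact: cylinder_agree.
have cYS : cylinder_event (agree (Y `\` S) a).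
  by apply: cylinder_agree; exact: finite_setD.
rewrite (PE _ cY) (PE _ cYS) -EFinM; congr EFin.
have lim : (weight S a / outside_partition S a *
      expect K \1_(agree (Y `\` S) a)) @[K --> finite_sets_filter] -->
    weight S a / outside_partition S a * fine (P (agree (Y `\` S) a)).
  by apply: cvgMr; exact: P_limit.
apply: finite_sets_limit_eq (P_limit cY) lim.
by exists Y => // K finK YK; exact: expect_agree_dlr.
Qed.

Let specification_stationary S : finite_set S -> forall C, measurable C ->
  (P C = \int[P]_eta specification U adj S eta C)%E.
Proof.
move=> finS.
pose N := neighborhood S; have finN : finite_set N by exact: finite_neighborhood.
(* Only windows containing the neighborhood of [S] are kept, where the specification is explicit.
   With the empty set added, these patterns are stable under intersection, and they still generate
   the sigma-algebra. *)
pose G : set (set (config V)) :=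
  [set B | B = set0 \/ exists Y a, [/\ finite_set Y, N `<=` Y & B = agree Y a]].
apply: (@stationary_pi_lambda _ _ R P (fun eta => specification U adj S eta) G).
- move=> _ _ [->|[Y [a [finY NY ->]]]] [->|[Z [b [finZ NZ ->]]]];
    rewrite ?set0I ?setI0; try by left.
  have [[n [na nb]]|H] := pselect (agree Y a `&` agree Z b !=set0); last first.
    by left; apply/seteqP; split => // n nab; apply: H; exists n.
  right; exists (Y `|` Z), n; split.
  - by rewrite finite_setU.
  - by move=> x /NY Yx; left.
  apply/seteqP; split => [n' [n'a n'b] x [Yx|Zx]|n' n'n].
    - by rewrite n'a// na.
    - by rewrite n'b// nb.
  split => x Hx.
    by rewrite n'n; [exact: na|left].
  by rewrite n'n; [exact: nb|right].
- have GY Y a : finite_set Y -> N `<=` Y -> <<s G >> (agree Y a).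
    by move=> finY NY; apply: sub_sigma_algebra; right; exists Y, a.
  apply/seteqP; split => A.
    apply: smallest_sub; first exact: smallest_sigma_algebra.
    move=> _ [x [k [_ ->]]].
    apply: (@determined_by_sigma _ _ (N `|` [set x])).
    + by rewrite finite_setU.
    + by move=> n n' nn' /= <-; rewrite nn'//; right.
    + by move=> a; apply: GY; [rewrite finite_setU|move=> y; left].
  apply: smallest_sub; first exact: sigma_algebra_measurable.
  move=> B [->|[Y [a [finY _ ->]]]]; first exact: measurable0.
  exact: measurable_agree.
- move=> _ [->|[Y [a [finY NY ->]]]].
    split.
      apply: (eq_measurable_fun (cst 0%E)); last exact: measurable_cst.
      by move=> eta _; rewrite /= measure0.
    by rewrite measure0 integral0_eq// => eta _; rewrite measure0.
  have mYS : measurable (agree (Y `\` S) a).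
    by apply: measurable_agree; exact: finite_setD.
  split.
    apply: (eq_measurable_fun (fun eta => (weight S a / outside_partition S a *
        \1_(agree (Y `\` S) a) eta)%:E)).
      by move=> eta _; rewrite specification_agree.
    by apply/measurable_EFinP; apply: measurable_funM.
  under eq_integral do rewrite specification_agree// EFinM.
  rewrite ge0_integralZl//.
  + by rewrite integral_indic// setIT; exact: agree_dlr.
  + exact/measurable_EFinP.
  + by rewrite lee_fin divr_ge0// ltW ?weight_gt0 ?outside_partition_gt0.
Qed.

(** An event [B] that does not see [S] is constant on the configurations agreeing with [eta] outside
    of [S], so the specification of the intersection of [A] and [B] is that of [A] times the
    indicator of [B]; stationarity does the rest. *)
Lemma infinite_volume_gibbs : gibbs_measure U adj P.
Proof.
move=> S finS A B mA sB.
have BE n eta : outside_agree S eta n -> B n <-> B eta.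
  have : <<s cylinders (~` S) >> `<=` [set B | forall n eta : config V,
      outside_agree S eta n -> B n <-> B eta].
    apply: smallest_sub; first split => //=.
    - move=> D HD n' eta' /HD H.
      by split=> -[_ nD]; split => // Dn; apply: nD; apply/H.
    - move=> F HF n' eta' ne; split => -[k _ Fk]; exists k => //.
        exact/(HF k n' eta' ne).
      exact/(HF k n' eta' ne).
    by move=> _ [x [k [Sx ->]]] n' eta' ne /=; rewrite ne.
  by move=> /(_ _ sB); apply.
have mB : measurable B.
  move: sB; apply: sub_sigma_algebra2 => _ [x [k [_ ->]]].
  by exists x, k.
rewrite (specification_stationary finS (measurableI _ _ mA mB)).
rewrite [RHS]integral_mkcond.
apply: eq_integral => eta _; rewrite patchE !specificationE//.
case: ifPn; rewrite ?inE ?notin_setE => Beta.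
  congr (_ * _)%E; congr esum; apply/seteqP; split => n [].
    by move=> [An _] ne.
  by move=> An ne; do !split => //; apply/(BE _ _ ne).
rewrite (_ : _ `&` _ = set0) ?esum_set0 ?mul0e//.
by apply/seteqP; split => // n [[_ Bn] ne]; exact: Beta ((BE _ _ ne).1 Bn).
Qed.

End infinite_volume.

(** * Relabelling by automorphisms *)

Lemma automorphism_bij s : automorphism adj s ->
  exists s', [/\ cancel s s', cancel s' s & forall x y, adj (s' x) (s' y) = adj x y].
Proof.
move=> [[s' sK s'K] hs]; exists s'; split => // x y.
by rewrite -{2}(s'K x) -{2}(s'K y) hs.
Qed.

Lemma weight_relabel s L n : automorphism adj s ->
  weight (s @` L) n = weight L (n \o s).
Proof.
move=> as_; have [s' [sK s'K hs']] := automorphism_bij as_.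
rewrite /weight /energy; congr (expR (- (_ * _))).
rewrite (@reindex_fsbig _ _ _ _ _ (fun e => (s e.1, s e.2))
  (edges_meeting adj L))//.
split.
- move=> e [ea Le]; split; rewrite /= ?as_.2//.
  by case: Le => Le; [left|right]; [exists e.1|exists e.2].
- move=> [x y] [x' y'] _ _ [/(can_inj sK) -> /(can_inj sK) ->] //.
- move=> [x y] [/= ea Le]; exists (s' x, s' y); rewrite /= ?s'K//.
  split; first by rewrite /= hs'.
  by case: Le => -[z Lz <-]; rewrite /= sK; [left|right].
Qed.

Lemma expect_relabel s L F : automorphism adj s ->
  expect (s @` L) (fun n => F (n \o s)) = expect L F.
Proof.
move=> as_; have [s' [sK s'K hs']] := automorphism_bij as_.
have bij : set_bij (supported_in (s @` L)) (supported_in L)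
    (fun n : config V => n \o s : config V).
  split.
  - move=> n Ln x Lx; apply: Ln => -[z Lz /(can_inj sK) zx].
    by apply: Lx; rewrite -zx.
  - move=> n m _ _ /funeqP nm; apply/funext => x.
    by have := nm (s' x); rewrite /= s'K.
  - move=> n Ln; exists (n \o s').
      move=> x Lx; apply: Ln => Lx'; apply: Lx; exists (s' x) => //.
    by apply/funext => x; rewrite /= sK.
rewrite /expect /mass; congr (fine _ / fine _);
  rewrite [RHS](reindex_esum _ _ _ _ bij); apply: eq_esum => n _;
  by rewrite weight_relabel.
Qed.

(** * Finite subgraphs with pinned boundary and exhausting sequences *)

Definition interior_vertices S : set V := [set x | S x /\ forall y, adj x y -> S y].

Lemma finite_interior S : finite_set S -> finite_set (interior_vertices S).
Proof. by apply: sub_finite_set => x []. Qed.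

Lemma neighborhood_interior K S : neighborhood K `<=` S ->
  K `<=` interior_vertices S.
Proof.
move=> KS x Kx; split; first by apply: KS; left.
by move=> y xy; apply: KS; right; exists x.
Qed.

(** The boundary of [S] is pinned to zero, so the free vertices are the interior ones; all edges
    meeting them lie in [S], and the edges between pinned vertices cancel in the normalization. *)
Lemma finite_volume_expect S (A : set (config V)) : finite_set S ->
  finite_volume U adj S A = (expect (interior_vertices S) \1_A)%:E.
Proof.
move=> finS; set K := interior_vertices S.
have finK : finite_set K by exact: finite_interior.
have DE : [set n : config V | forall x, ~ S x \/ boundary adj S x -> n x = 0] =
    supported_in K.
  apply/seteqP; split => n Hn x.
    move=> Kx; apply: Hn; have [Sx|Sx] := pselect (S x); last by left.
    right; split => //; apply: contra_notP Kx => H; split => // y xy.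
    by apply: contra_notP H => Sy; exists y.
  by move=> Hx; apply: Hn => -[Sx nS]; case: Hx => // -[_ [y /nS]].
have finE : finite_set (edges_inside adj S).
  by apply: sub_finite_set (finite_setX finS finS) => e [].
have [||c0 c00 cE] := @expR_energy_supported K (edges_inside adj S) finE.
- move=> [x y] [/= xy Kxy]; split => //=.
    by case: Kxy => -[Sx nS] //; apply: nS; rewrite adj_sym.
  by case: Kxy => -[Sx nS] //; apply: nS.
- by move=> e [].
have bE B : boltzmann U (edges_inside adj S)
    [set n : config V | forall x, ~ S x \/ boundary adj S x -> n x = 0] B =
    (c0%:E * mass K (fun n => (weight K n * \1_B n)%R))%E.
  rewrite DE mass_indic -esumZl ?ltW//; last first.
    by move=> n _; rewrite lee_fin weight_ge0.
  by rewrite /boltzmann setIC; apply: eq_esum => n [Kn _]; rewrite cE.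
have mT : mass K (fun n => weight K n * \1_setT n) = mass K (weight K).
  by apply: eq_esum => n _; rewrite indicT mulr1.
have Zfin := Wmass_fin finK; have Zgt := Wmass_gt0 finK.
rewrite /finite_volume /= /mnormalize /= !bE mT -(fineK Zfin) -EFinM.
rewrite eqe gt_eqF ?mulr_gt0//=.
transitivity (c0%:E * mass K (fun n => (weight K n * \1_A n)%R) *
    ((c0 * fine (mass K (weight K)))^-1)%:E)%E.
  by congr (_ * _)%E; exact: bE.
rewrite -(fineK (mass_bounded_fin finK (bounded_nonneg_indic A))).
rewrite -!EFinM /expect /=; congr EFin.
by field; rewrite !gt_eqF.
Qed.

(** Degrees are finite, so the neighborhood of [K] is finite and eventually contained in [G L]; from
    then on [K] avoids the boundary of [G L]. *)
Lemma exhausting_near G K : exhausting G -> finite_set K ->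
  \forall L \near \oo, K `<=` interior_vertices (G L).
Proof.
move=> [finG GS GT] finK; have finN := finite_neighborhood finK.
have mono i j : (i <= j)%N -> G i `<=` G j.
  move=> /subnK <-; elim: (j - i)%N => // k IH; apply: subset_trans IH _.
  exact: GS.
have [i Hi] : exists i, neighborhood K `<=` G i.
  have /choice[f Hf] : forall x, exists i, G i x.
    by move=> x; have : [set: V] x by []; rewrite -GT => -[i _ Gi]; exists i.
  exists (\max_(x <- fset_set (neighborhood K)) f x)%N => x Nx.
  apply: mono (Hf x); apply: leq_bigmax_seq => //.
  by rewrite in_fset_set// inE.
exists i => // j ij; apply: neighborhood_interior.
exact: subset_trans Hi (mono _ _ ij).
Qed.

Lemma exhausting_countable (G : nat -> set V) : exhausting G -> countable [set: V].
Proof.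
move=> [finG _ <-]; apply: bigcup_countable => // i _.
exact: finite_set_countable.
Qed.

Lemma exhausting_expect_cvg G (f : set V -> R) (l : R) : exhausting G ->
  f K @[K --> finite_sets_filter] --> l ->
  f (interior_vertices (G L)) @[L --> \oo] --> l.
Proof.
move=> hG; apply: cvg_comp => A [K0 finK0 HA].
apply: filterS (exhausting_near hG finK0) => L /HA; apply.
by apply: finite_interior; have [] := hG.
Qed.

(** * From second moments to tightness at one vertex *)

Section second_moment.
Variables (G : nat -> set V) (x : V) (M : R).
Hypothesis hG : exhausting G.
Hypothesis moment_le : forall L,
  ('E_(finite_volume U adj (G L))[fun n => ((n x)%:~R ^+ 2)%R] <= M%:E)%E.

(** Chebyshev's inequality; [tail x J] means that [|n x|] is at least [J.+1]. *)
Let tail_moment L J :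
  expect (interior_vertices (G L)) \1_(tail x J) * (J.+1%:R ^+ 2) <= M.
Proof.
have [finG _ _] := hG; rewrite -lee_fin; apply: le_trans (moment_le L).
rewrite EFinM -finite_volume_expect// unlock muleC.
set Q := finite_volume U adj (G L).
have mT : measurable (tail x J).
  apply: measurable_cylinder_event; exists [set x] => //.
  by move=> n n' nn'; rewrite /tail/= nn'.
have -> : ((J.+1%:R ^+ 2)%:E * Q (tail x J) =
    \int[Q]_n (J.+1%:R ^+ 2 * \1_(tail x J) n)%:E)%E.
  under eq_integral do rewrite EFinM.
  rewrite ge0_integralZl//.
  - by rewrite integral_indic// setIT.
  exact/measurable_EFinP.
apply: ge0_le_integral => //.
- by apply/measurable_EFinP; apply: measurable_funM.
- apply/measurable_EFinP; apply: (@measurable_fun_determined _ _ _ _ [set x]) => //.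
  by move=> n n' nn'; rewrite nn'.
move=> n _; rewrite lee_fin indicE; case: (boolP (n \in _)); last first.
  by rewrite mulr0 sqr_ge0.
rewrite inE /tail/= mulr1 => Jn.
rewrite -[leRHS]real_normK ?num_real// ler_sqr ?nnegrE ?normr_ge0//.
by rewrite -intr_norm -natr_absz ler_nat.
Qed.

(** The moments control the tails in the interiors of the [G L]. These are cofinal among the finite
    volumes, which is what the transfer to all volumes requires. *)
Lemma second_moment_tight : tight_at x.
Proof.
have M0 : 0 <= M.
  apply: le_trans (tail_moment 0%N 0%N); rewrite mulr_ge0 ?sqr_ge0//.
  by apply: expect_ge0 => n; exact: (bounded_nonneg_indic _).1.
apply: tight_at_cofinal => e e0; pose J := Num.bound (M / e); exists J => K0 finK0.
have [L _ /(_ L (leqnn _)) K0L] := exhausting_near hG finK0.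
exists (interior_vertices (G L)).
  by split => //; apply: finite_interior; have [] := hG.
have := tail_moment L J.
have : M / e < J%:R by apply: archi_boundP; rewrite divr_ge0// ltW.
rewrite ltr_pdivrMr// => MJ; set p := expect _ _ => pM.
have J1 : (J%:R : R) <= J.+1%:R ^+ 2.
  rewrite -natrX ler_nat; apply: leq_trans (leqnSn J) _.
  by rewrite -[leqLHS]expn1 leq_pexp2l.
have p0 : 0 < (J.+1%:R : R) ^+ 2 by rewrite exprn_gt0.
rewrite -(ler_pM2r p0); apply: le_trans pM _; apply: le_trans (ltW MJ) _.
by rewrite mulrC ler_wpM2l// ltW.
Qed.

End second_moment.

(** * Convergence along exhausting sequences and invariance *)

Section limit_properties.
Variable P : probability (config V) R.
Hypothesis P_limit : forall A, cylinder_event A ->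
  expect K \1_A @[K --> finite_sets_filter] --> fine (P A).

Lemma infinite_volume_fdd_cvg G : exhausting G ->
  fdd_cvg (fun L => finite_volume U adj (G L)) P.
Proof.
move=> hG F finF A AF; have cA : cylinder_event A by exists F.
have [finG _ _] := hG.
rewrite -[P A]fineK; last first.
  by rewrite fin_num_measure//; exact: measurable_cylinder_event.
under eq_fun do rewrite finite_volume_expect//.
apply: cvg_EFin; first by near=> L.
exact: exhausting_expect_cvg hG (P_limit cA).
Unshelve. all: by end_near. Qed.

Lemma infinite_volume_invariant : automorphism_invariant adj P.
Proof.
move=> s as_; have [s' [sK s'K hs']] := automorphism_bij as_.
pose f (n : config V) : config V := n \o s.
have cf A : cylinder_event A -> cylinder_event (f @^-1` A).
  move=> [Y finY AY]; exists (s @` Y); first exact: finite_image.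
  by move=> n n' nn'; apply: AY => y Yy; apply: nn'; exists y.
have mf : measurable_fun setT f.
  apply: (measurability _ measurable_cylinder_sigma) => _ [A cA <-].
  by rewrite setTI; apply: measurable_cylinder_event; exact: cf.
pose X : {mfun config V >-> config V} := mfun_Sub (mem_set mf).
move=> A mA; rewrite -[LHS]/(distribution P X A).
apply: (probability_cylinder_unique _ mA) => {mA}A cA.
have PE B : cylinder_event B -> P B = (fine (P B))%:E.
  by move=> cB; rewrite fineK// fin_num_measure//; exact: measurable_cylinder_event.
rewrite -[LHS]/(P (f @^-1` A)) (PE _ cA) (PE _ (cf _ cA)); congr EFin.
(* The image of [K] under [s] also runs along the directed set: it contains [K0] as soon as [K]
   contains the image of [K0] under [s']. *)
have lim : expect (s @` K) \1_(f @^-1` A) @[K --> finite_sets_filter] -->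
    fine (P (f @^-1` A)).
  apply: cvg_comp (P_limit (cf _ cA)) => B [K0 finK0 HB].
  exists (s' @` K0); first exact: finite_image.
  move=> K finK K0K; apply: HB; first exact: finite_image.
  by move=> x K0x; exists (s' x); [apply: K0K; exists x|rewrite s'K].
apply: finite_sets_limit_eq lim (P_limit cA).
exists set0 => // K finK _; rewrite -(expect_relabel K \1_A as_).
by apply: eq_expect => n _.
Qed.

End limit_properties.

End gibbs_weights.

(** * Consequences of the periodic planar drawing *)

Section planar_graph.
Context {R : realType} {V : choiceType} (adj : rel V) (D : drawing R adj).

Lemma arc_near x y (e : R) : adj x y -> 0 < e ->
  exists2 t, `]0, 1[%classic t & ball (pos D x) e (Defs.arc D x y t).
Proof.
move=> xy e0.
have [_ + _] := (continuous_within_itvP (Defs.arc D x y) ltr01).1 (arc_continuous xy).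
rewrite arc0// => /(_ (ball (pos D x) e))[|d /= d0 Hd]; first exact: nbhsx_ballx.
pose t := Num.min (d / 2) (1 / 2) : R.
have t0 : 0 < t by rewrite lt_min !divr_gt0.
have td : t < d by rewrite gt_min ltr_pdivrMr// ltr_pMr// ltr1n.
have t1 : t < 1 by rewrite gt_min [X in _ || X]ltr_pdivrMr// mul1r ltr1n orbT.
exists t; first by rewrite /= in_itv/= t0.
by apply: Hd => //=; rewrite sub0r normrN gtr0_norm.
Qed.

(* Choose on the edges at a vertex x of infinite degree inner points tending to
   x. Every edge contains at most two of them, so that their complement is open
   in the cell complex, although x is an accumulation point of them. *)
Lemma locally_finite : countable [set: V] -> forall x, finite_set [set y | adj x y].
Proof.
move=> /countable_injP[k kinj] x; set N := [set y | _]; apply: contrapT => infN.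
have /choice[t Ht] : forall y, exists t, adj x y ->
    `]0, 1[%classic t /\ ball (pos D x) ((k y).+1%:R^-1) (Defs.arc D x y t).
  move=> y; have [xy|xy] := boolP (adj x y); last by exists 0.
  have [|t t01 Bt] := @arc_near x y (k y).+1%:R^-1 xy.
    by rewrite invr_gt0.
  by exists t.
pose T := [set Defs.arc D x y (t y) | y in N].
have [|O openO HO] := @arc_weak_topology _ _ _ D (~` T).
  move=> u v uv.
  (* By [arc_meet], a chosen point on the arc from [u] to [v] was chosen on that same edge: either
     [x = u], with the parameter [t v], or [x = v], with the parameter [1 - t u]. *)
  pose B := [set s | [set t v; 1 - t u] s /\ T (Defs.arc D u v s)].
  have finB : finite_set B 
      by apply: (sub_finite_set _ (finite_set2 (t v) (1 - t u))) => s [].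
  exists (~` B).
    apply: closed_openC; move: finB.
    exact: (accessible_finite_set_closed.1 (hausdorff_accessible (@norm_hausdorff _ R))).
  apply/seteqP; split => s [s01 Hs]; split => //; first by move=> [_].
  move=> [y xy ys]; apply: Hs; split; last by exists y.
  have [ty01 _] := Ht y xy.
  have s01' : `]0, 1[%classic s.
    move: s01; rewrite /= !in_itv/= => /andP[s0 s1].
    rewrite lt_neqAle s0 andbT lt_neqAle s1 andbT; apply/andP; split.
      apply/eqP => s0'; move: ys; rewrite -s0' arc0// => /eqP.
      by apply/negP; exact: arc_avoids_pos.
    apply/eqP => s1'; move: ys; rewrite s1' arc1// => /eqP.
    by apply/negP; exact: arc_avoids_pos.
  have [[_ <- <-]|[-> _ ->]] := arc_meet uv xy s01' ty01 (esym ys); first by left.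
  by right.
have xO : O (pos D x).
  have : (range (pos D) `|` [set p | exists x0 y, adj x0 y /\
      (Defs.arc D x0 y @` `[0, 1]) p]) (pos D x) /\ (~` T) (pos D x).
    split; first by left; exists x.
    move=> [y xy] /eqP; apply/negP; apply: arc_avoids_pos => //.
    exact: (Ht y xy).1.
  by move: HO => /seteqP[+ _] => /[apply] -[].
have /nbhs_ballP[e /= e0 eO] : nbhs (pos D x) O by exact: open_nbhs_nbhs.
(* [k] is injective, so among infinitely many neighbors one has an index large enough for its chosen
   point to lie within [e] of [pos D x]. *)
have [y xy ye] : exists2 y, N y & (Num.bound e^-1 <= k y)%N.
  apply: contrapT => H; apply: infN.
  apply: (@sub_finite_set _ _ (k @^-1` `I_(Num.bound e^-1))).
    move=> y Ny /=; rewrite ltnNge; apply/negP => ye; apply: H; by exists y.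
  apply: finite_preimage; last exact: finite_II.
  by move=> y z _ _; apply: kinj; rewrite inE.
have [t01 Bt] := Ht y xy.
have tO : O (Defs.arc D x y (t y)).
  apply: eO; apply: le_ball Bt; rewrite -[leRHS]invrK lef_pV2 ?posrE ?invr_gt0//.
  apply: ltW; apply: lt_le_trans (archi_boundP _) _; first by rewrite invr_ge0 ltW.
  by rewrite ler_nat; apply: leq_trans ye _.
move: HO => /seteqP[_ /(_ (Defs.arc D x y (t y)))] [].
  split => //; right; exists x, y; split => //; exists (t y) => //.
  by move: t01; rewrite /= !in_itv/= => /andP[/ltW -> /ltW ->].
by move=> _; apply; exists y.
Qed.

Lemma doubly_periodic_infinite (x : V) : doubly_periodic D -> ~ finite_set [set: V].
Proof.
move=> per finV.
have /choice[f Hf] : forall i : nat, exists y, pos D y = pos D x + (i%:R, 0).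
  by move=> i; have [s [_ sp _]] := per i%:Z 0; exists (s x).
have : finite_set (f @^-1` [set: V]).
  apply: finite_preimage finV => i j _ _ fij.
  have := Hf i; rewrite fij Hf => /addrI[] /eqP.
  by rewrite eqr_nat => /eqP.
rewrite preimage_setT; exact: infinite_nat.
Qed.

End planar_graph.

Theorem proposition10p7 (R : realType) (V : choiceType) (adj : rel V)
  (G : nat -> set V) (U : int -> R)
  (hgraph : simple_graph adj)
  (hconn : connected_graph adj)
  (hplane : exists D : drawing R adj, doubly_periodic D /\ tame D)
  (hG : exhausting G)
  (hconvex : convex_interaction U)
  (hgauss : annealed_gaussian U)
  (hnonconst : nonconstant U)
  (hsup : exists x : V, (ereal_sup (range (fun L : nat =>
     'E_(finite_volume U adj (G L))[fun n => ((n x)%:~R ^+ 2)%R])) < +oo)%E) :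
  exists P : probability (config V) R,
    [/\ fdd_cvg (fun L => finite_volume U adj (G L)) P,
        gibbs_measure U adj P,
        forall G' : nat -> set V, exhausting G' ->
          fdd_cvg (fun L => finite_volume U adj (G' L)) P &
        automorphism_invariant adj P].
Proof.
have [adj_sym adj_irr] := hgraph; have [D [per _]] := hplane.
have [mu Umu] := hgauss; have [x supx] := hsup.
have countV := exhausting_countable hG.
have adj_fin := locally_finite D countV.
have V_infinite := doubly_periodic_infinite x per.
(* The mixture depends on [q] through its square only, which makes [U] even. *)
have U_even q : U (- q) = U q by apply/oppr_inj/expR_inj/(mixture_even Umu).
have [c c0 [C U_growth]] := convex_even_growth hconvex hnonconst U_even.
have h_pd := posker_mixture Umu; have h_pair := posker_mixture_pair Umu.
have [M HM] : exists M : R, forall L,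
    ('E_(finite_volume U adj (G L))[fun n => ((n x)%:~R ^+ 2)%R] <= M%:E)%E.
  set f := (fun L : nat => _) in supx.
  have f0 L : (0 <= f L)%E.
    by rewrite /f unlock; apply: integral_ge0 => n _; rewrite lee_fin sqr_ge0.
  have fM L : (f L <= ereal_sup (range f))%E by apply: ereal_sup_ubound; exists L.
  exists (fine (ereal_sup (range f))) => L; rewrite fineK ?fM//.
  by rewrite ge0_fin_numE//; apply: le_trans (fM 0%N).
have tight : forall y, tight_at adj U y.
  have tx := second_moment_tight adj_sym adj_irr adj_fin U_even c0 U_growth hconn
    V_infinite h_pair hG HM.
  move=> y; exact: (tight_at_all adj_sym adj_irr adj_fin U_even c0 U_growth hconn
    V_infinite h_pd y tx).
have [P P_limit] : exists P : probability (config V) R,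
    forall A, cylinder_event A ->
    expect adj U K \1_A @[K --> @finite_sets_filter V] --> fine (P A).
  exact: (infinite_volume_measure adj_sym adj_irr adj_fin U_even c0 U_growth hconn
    V_infinite h_pair countV tight).
have fdd G' : exhausting G' -> fdd_cvg (fun L => finite_volume U adj (G' L)) P.
  exact: (infinite_volume_fdd_cvg adj_sym adj_fin c0 U_growth hconn V_infinite P_limit).
exists P; split => //; first exact: fdd.
- exact: (infinite_volume_gibbs adj_sym adj_fin c0 U_growth hconn V_infinite P_limit).
- exact: infinite_volume_invariant P_limit.
Qed.
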